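(* Let $n\ge 1$, let $[\![Q^{\diamondsuit}]\!]$ be the twisted adapted cluster point of type $A_{2n+1}$, and let $[\![Q]\!]$ be the adapted cluster point of type $A_{2n}$ (the set of all commutation classes $[Q']$ adapted to Dynkin quivers $Q'$ of type $A_{2n}$). (1) The map $P:[\![Q^{\diamondsuit}]\!]\to[\![Q]\!]$, $[\mathbf i]\mapsto[P(\mathbf i)]$, is two-to-one and onto. (2) Every class $[\mathbf i]\in[\![Q^{\diamondsuit}]\!]$ has $n+1$ as a source or as a sink, but not both. (3) For each Dynkin quiver $Q'$ of type $A_{2n}$, the set $P^{-1}([Q'])$ is obtained by the following procedure: (i) take a reduced word of the longest element of $W_{2n}$ adapted to $Q'$; (ii) replace each letter $i\in\{n+1,\dots,2n\}$ in it by $i+1$; (iii) insert a letter $n+1$ between each adjacent $n$ and $n+2$ (i.e. between any two letters $n,n+2$ that are consecutive in the subword formed by the letters $n$ and $n+2$); (iv) insert one more letter $n+1$ either at the beginning or at the end (not both) of the word obtained in (iii). The positions chosen for the letters $n+1$ in (iii) are not unique, but the resulting commutation class does not depend on them; the two choices in (iv) give two distinct commutation classes. (4) The number of commutation classes in $[\![Q^{\diamondsuit}]\!]$ is $2^{2n}$. (5) The number of twisted Coxeter elements of type $A_{2n+1}$ is $4\times 3^{n-1}$. (6) To each twisted Coxeter element $s_{i_1}s_{i_2}\cdots s_{i_{n+1}}\vee$ of type $A_{2n+1}$ one associates the word $\prod_{k=0}^{2n}(i_1\,i_2\cdots i_{n+1})^{k\vee}$, which is a reduced expression of the longest element of $W_{2n+1}$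 whose commutation class belongs to $[\![Q^{\diamondsuit}]\!]$. (7) The image under $P$ of the class associated in (6) to a twisted Coxeter element is $[Q']$ for a Dynkin quiver $Q'$ of type $A_{2n}$ such that $|a_i-b_i|=1$ for all $i\in\{1,\dots,2n\}$, where $a_i$ (resp. $b_i$) is the number of arrows of $Q'$ lying between the vertices $i$ and $2n+1-i$ that are directed toward $i$ (resp. toward $2n+1-i$).
   Context: For $m\ge1$ let $I_m=\{1,\dots,m\}$ and let $W_m$ be the Weyl group of type $A_m$ with simple reflections $s_1,\dots,s_m$ and longest element $w_0$ of length $N=m(m+1)/2$. Reduced words of $w_0$ are commutation equivalent if one is obtained from the other by swapping neighbouring letters $i,j$ with $|i-j|\ge2$; $[\mathbf i]$ denotes the commutation class of $\mathbf i$. An index $i$ is a sink (resp. source) of $[\mathbf i]$ if some word in $[\mathbf i]$ starts (resp. ends) with $i$. Put $i^*=m+1-i$. Reflection functors: if $i$ is a sink and $i\,i_2\cdots i_N\in[\mathbf i]$ then $[\mathbf i]r_i=[i_2\cdots i_N\,i^*]$, otherwise $[\mathbf i]r_i=[\mathbf i]$; if $i$ is a source and $i_1\cdots i_{N-1}\,i\in[\mathbf i]$ then $r_i[\mathbf i]=[i^*\,i_1\cdots i_{N-1}]$, otherwise $r_i[\mathbf i]=[\mathbf i]$. Two classes are reflection equivalent if one is obtained from the other by a sequence of reflection functors; an equivalence class is an $r$-cluster point $[\![\mathbf i]\!]$. In type $A_{2n+1}$ let $i^\vee=2n+2-i$, the non-trivial Dynkin diagram automorphism. For a word, $(j_1\cdots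 j_l)^{k\vee}$ is the word obtained by applying $\vee$ to every letter $k$ times; products of words are concatenations in increasing order of $k$. The twisted adapted cluster point $[\![Q^{\diamondsuit}]\!]$ is the $r$-cluster point of the reduced word $\mathbf i_0=\prod_{k=0}^{2n}(1\,2\cdots n{+}1)^{k\vee}$ of $w_0\in W_{2n+1}$. A twisted Coxeter element of type $A_{2n+1}$ is an element $w\vee$ of the coset $W_{2n+1}\vee$ (where $\vee$ is viewed as a linear map permuting simple roots), with $w=s_{i_1}\cdots s_{i_{n+1}}$ a product, in any order, of simple reflections chosen exactly one from each $\vee$-orbit of indices. $P$ is the monoid homomorphism from words in $I_{2n+1}$ to words in $I_{2n}$ with $P(i)=i$ for $i\le n$, $P(n+1)=$ empty word, $P(j)=j-1$ for $n+2\le j\le 2n+1$; for $[\mathbf i]\in[\![Q^{\diamondsuit}]\!]$ the class $[P(\mathbf i)]$ depends only on $[\mathbf i]$. A Dynkin quiver $Q'$ of type $A_{2n}$ is an orientation of the Dynkin diagram; for a sink or source $i$ of $Q'$, $i\,Q'$ denotes the quiver obtained by reversing all arrows at $i$. A reduced word $i_1\cdots i_l$ is adapted to $Q'$ if $i_k$ is a sink of $i_{k-1}\cdots i_1\,Q'$ for all $k$. The reduced words of $w_0$ adapted to $Q'$ form one commutation class $[Q']$, and all $[Q']$ form one $r$-cluster point $[\![Q]\!]$. *)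

(* Defs.v *)
From mathcomp Require Import all_boot all_order all_algebra.
From mathcomp Require Import boolp classical_sets functions cardinality.

Set Implicit Arguments.
Unset Strict Implicit.
Unset Printing Implicit Defensive.

Import GRing.Theory Num.Theory.

Local Open Scope classical_set_scope.
Local Open Scope nat_scope.

(* Letters are numbered from 1, as in I_m = {1, ..., m}; in matrices the
   ordinal j : 'I_m stands for the index j.+1. *)
Notation word := (seq nat).

Definition letter (m i : nat) : bool := (1 <= i <= m).

Definition word_in (m : nat) (w : word) : bool := all (letter m) w.

Definition adjacent (i j : nat) : bool := (j == i.+1) || (i == j.+1).

(* The Weyl group of type A_m is realized by its action on the span of the
   simple roots; columns are coordinates with respect to the simple roots. *)
Definition cartan (i j : nat) : rat :=
  (if i == j then 2 else if adjacent i j then -1 else 0)%R.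

(* s_i(alpha_j) = alpha_j - a_ij alpha_i *)
Definition simple_refl (m i : nat) : 'M[rat]_m :=
  (\matrix_(k, j) ((k == j)%:R - (k.+1 == i)%:R * cartan i j.+1))%R.

Definition word_mx (m : nat) (w : word) : 'M[rat]_m :=
  \big[mulmx/1%:M%R]_(i <- w) simple_refl m i.

Definition weyl (m : nat) : set 'M[rat]_m :=
  [set A | exists2 w, word_in m w & word_mx m w = A].

Definition reduced (m : nat) (w : word) : Prop :=
  word_in m w /\
  forall w', word_in m w' -> word_mx m w' = word_mx m w -> size w <= size w'.

Definition longest (m : nat) (A : 'M[rat]_m) : Prop :=
  weyl A /\
  forall w w', reduced m w -> reduced m w' -> word_mx m w = A ->
    size w' <= size w.

Definition reduced_w0 (m : nat) (w : word) : Prop :=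
  reduced m w /\ longest (word_mx m w).

Inductive comm_eq : word -> word -> Prop :=
| comm_refl w : comm_eq w w
| comm_swap u v i j : (i.+1 < j) || (j.+1 < i) ->
    comm_eq (u ++ [:: i, j & v]) (u ++ [:: j, i & v])
| comm_trans w1 w2 w3 : comm_eq w1 w2 -> comm_eq w2 w3 -> comm_eq w1 w3.

Definition comm_class (w : word) : set word := [set w' | comm_eq w w'].

Definition is_sink (c : set word) (i : nat) : Prop := exists u, c (i :: u).

Definition is_source (c : set word) (i : nat) : Prop := exists u, c (rcons u i).

Definition star (m i : nat) : nat := m.+1 - i.

(* The words u with i :: u (resp. rcons u i) in a given commutation class c are
   all commutation equivalent, so each union below is a single class. *)
Definition refl_right (m : nat) (c : set word) (i : nat) : set word :=
  if `[< is_sink c i >] then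
    \bigcup_(u in [set u | c (i :: u)]) comm_class (rcons u (star m i))
  else c.

Definition refl_left (m i : nat) (c : set word) : set word :=
  if `[< is_source c i >] then
    \bigcup_(u in [set u | c (rcons u i)]) comm_class (star m i :: u)
  else c.

(* On classes of reduced words of the longest element this is symmetric: when
   refl_right at i acts non-trivially it is undone by refl_left at star m i,
   and conversely. *)
Inductive refl_equiv (m : nat) (c : set word) : set word -> Prop :=
| refl_equiv_refl : refl_equiv m c c
| refl_equiv_right d i :
    letter m i -> refl_equiv m c d -> refl_equiv m c (refl_right m d i)
| refl_equiv_left d i :
    letter m i -> refl_equiv m c d -> refl_equiv m c (refl_left m i d).

Definition cluster_point (m : nat) (w : word) : set (set word) :=
  [set c | refl_equiv m (comm_class w) c].

Definition vee (n i : nat) : nat := n.*2.+2 - i.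

Definition vee_pow (n k : nat) (w : word) : word := iter k (map (vee n)) w.

Definition twisted_word (n : nat) (w : word) : word :=
  flatten [seq vee_pow n k w | k <- iota 0 n.*2.+1].

Definition twisted_cluster (n : nat) : set (set word) :=
  cluster_point n.*2.+1 (twisted_word n (iota 1 n.+1)).

Definition vee_transversal (n : nat) (w : word) : Prop :=
  word_in n.*2.+1 w /\
  forall i, letter n.*2.+1 i -> count (pred2 i (vee n i)) w = 1.

Definition vee_mx (n : nat) : 'M[rat]_(n.*2.+1) :=
  (\matrix_(k, j) (k.+1 == vee n j.+1)%:R)%R.

(* The element s_{i_1} ... s_{i_l} vee of the coset of vee *)
Definition coset_mx (n : nat) (w : word) : 'M[rat]_(n.*2.+1) :=
  (word_mx n.*2.+1 w *m vee_mx n)%R.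

Definition twisted_coxeter (n : nat) : set 'M[rat]_(n.*2.+1) :=
  [set A | exists2 w, vee_transversal n w & coset_mx n w = A].

Definition P_word (n : nat) (w : word) : word :=
  [seq (if i <= n then i else i.-1) | i <- w & i != n.+1].

Definition P_class (n : nat) (c : set word) : set word :=
  \bigcup_(w in c) comm_class (P_word n w).

(* q i j means that there is an arrow i -> j. *)
Definition dynkin_quiver (m : nat) (q : rel nat) : Prop :=
  (forall i j, q i j -> [&& letter m i, letter m j & adjacent i j]) /\
  (forall i j, letter m i -> letter m j -> adjacent i j -> q i j (+) q j i).

Definition quiver_sink (m : nat) (q : rel nat) (i : nat) : Prop :=
  letter m i /\ forall j, ~~ q i j.

Definition reverse_at (i : nat) (q : rel nat) : rel nat :=
  fun j k => if (j == i) || (k == i) then q k j else q j k.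

Fixpoint adapted (m : nat) (q : rel nat) (w : word) : Prop :=
  if w is i :: w' then quiver_sink m q i /\ adapted m (reverse_at i q) w'
  else True.

Definition quiver_class (m : nat) (q : rel nat) : set word :=
  [set w | reduced_w0 m w /\ adapted m q w].

Definition adapted_cluster (m : nat) : set (set word) :=
  [set c | exists2 q, dynkin_quiver m q & c = quiver_class m q].

(* Number of arrows of q lying between i and j that are directed toward i *)
Definition arrows_toward (q : rel nat) (i j : nat) : nat :=
  \sum_(minn i j <= k < maxn i j) (if i < j then q k.+1 k else q k k.+1).

Definition P_fiber (n : nat) (q : rel nat) : set (set word) :=
  [set c | twisted_cluster n c /\ P_class n c = quiver_class n.*2 q].

Definition relabel (n : nat) (u : word) : word :=
  [seq (if n < i then i.+1 else i) | i <- u].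

Fixpoint separate (z : nat) (s : word) : word :=
  if s is x :: s' then
    if s' is y :: _ then x :: nseq (x != y) z ++ separate z s'
    else s
  else s.

(* v is obtained from u by insertion of letters n+1, one between any two
   distinct letters n, n+2 that are consecutive in the subword of u formed by
   these letters, and none elsewhere. *)
Definition inserted (n : nat) (u v : word) : Prop :=
  [seq i <- v | i != n.+1] = u /\
  [seq i <- v | i \in [:: n; n.+1; n.+2]] =
    separate n.+1 [seq i <- u | i \in [:: n; n.+2]].

Definition lifted (n : nat) (first : bool) (u w : word) : Prop :=
  exists2 v, inserted n (relabel n u) v &
    w = if first then n.+1 :: v else rcons v n.+1.

(* Main.v *)
Require Import Defs.
From mathcomp Require Import all_boot all_order all_algebra.
From mathcomp Require Import boolp classical_sets functions cardinality.
From mathcomp Require Import zify ring lra.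

Import Order.TTheory GRing.Theory Num.Theory.

Local Open Scope classical_set_scope.
Local Open Scope card_scope.
Local Open Scope nat_scope.

Set Implicit Arguments.
Unset Strict Implicit.
Unset Printing Implicit Defensive.

(** Reflection functors move a window along a two-sided infinite periodic word, up
to commutations. The classes of the twisted cluster are the positions of the
window, and each position is described by the lower border of the remaining
heap, encoded as follows.

A height assigns an integer to each letter, and a letter lying below its
neighbours may be fired, which raises it. Two firing sequences with the same
end points are commutation equivalent ([leads_uniq]), so the firing sequences
between two given heights form one commutation class. In type [A_{2n}],
orientations of the diagram are the same as heights with differences 2 between
neighbours, up to translation, and adapted words are firing sequences. In type
[A_{2n+1}] the letters [n] and [n+2] take the place of the two central letters
of [A_{2n}], and [n+1] moves at double speed between them
([twisted_height]).

Windows of the heap from a height to its mirror image, raised by twice the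
Coxeter number of [A_{2n}], are the words of the longest element. For this, the
word is read as a wiring diagram whose wires are straight lines reflected at
the borders. Each wire has a phase, which does not change, and the phases at
the end of the window are those of the beginning at the mirror positions
([zigzag_reverses], [twisted_reduced]). Conversely, since the phases determine
the height up to periods, any reduced adapted word of the longest element is
such a window ([reduced_leads]); this makes [quiver_class] one commutation
class.

A reflection functor moves the window by one letter, and any twisted height can
be reached from any other one by firing, up to translation. Therefore the
cluster consists of the classes of all twisted heights
([cluster_point_twisted]). Such a class is given by an orientation of the
diagram of type [A_{2n}] and by one bit which tells whether [n+1] lies below or
above the lower one of its neighbours, that is, whether [n+1] is a sink or a
source. Erasing [n+1] forgets this bit, which gives the two-to-one map and the
number [2^(2n)]; the insertion procedure restores the letters [n+1]
([lifted_twisted]).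

A twisted Coxeter word is a firing sequence from a height to its mirror image
raised by 2, and the product of its [2n+1] twisted copies runs through the
whole window ([coxeter_twisted]). The heights of a letter and of its mirror
image then differ by exactly 2, which is the condition on arrows; and, going
outwards from the centre, such heights are built by two binary choices followed
by [n-1] ternary ones. Distinct choices give distinct group elements because a
product of distinct simple reflections determines its word up to commutations
([uniq_act_comm]). *)

(** * Commutation classes *)

Lemma comm_sym u v : comm_eq u v -> comm_eq v u.
Proof.
elim=> [w|{}u {}v i j ij|w1 w2 w3 _ h12 _ h23]; first exact: comm_refl.
  by apply: comm_swap; rewrite orbC.
exact: comm_trans h23 h12.
Qed.

Lemma comm_catr u v w : comm_eq v w -> comm_eq (u ++ v) (u ++ w).
Proof.
elim=> [{}w|p q i j ij|w1 w2 w3 _ h12 _ h23]; first exact: comm_refl.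
  by rewrite !catA; apply: comm_swap.
exact: comm_trans h12 h23.
Qed.

Lemma comm_cons i v w : comm_eq v w -> comm_eq (i :: v) (i :: w).
Proof. exact: (@comm_catr [:: i]). Qed.

Lemma comm_perm v w : comm_eq v w -> perm_eq v w.
Proof.
elim=> [{}w|p q i j ij|w1 w2 w3 _ h12 _ h23]; first exact: perm_refl.
  by rewrite perm_cat2l -cat1s -(cat1s j) perm_catCA.
exact: perm_trans h12 h23.
Qed.

Lemma adjacent_sym i j : adjacent i j = adjacent j i.
Proof. by rewrite /adjacent orbC. Qed.

Lemma comm_front i w : i \in w ->
  (forall j, j \in take (index i w) w -> ~~ adjacent i j) ->
  comm_eq w (i :: rem i w).
Proof.
elim: w => //= j w IH; case: (eqVneq j i) => [->|ji] iw hw.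
  exact: comm_refl.
have {}iw : i \in w by rewrite inE eq_sym (negPf ji) in iw.
apply: comm_trans (comm_cons j (IH iw _)) _.
  by move=> k kw; apply: hw; rewrite /= inE kw orbT.
apply: (comm_swap [::]); have := hw j; rewrite /= inE eqxx => /(_ isT).
rewrite /adjacent; lia.
Qed.

(** * Firing sequences *)

(** A height is attached to every letter. A letter may be fired when it lies
strictly below its neighbours, and is then raised by the amount [d]. In this
way a whole heap of letters is recorded by its lower border. *)
Notation height := (nat -> int).

Definition fire (d : height) (i : nat) (x : height) : height :=
  fun j => if j == i then (x j + d j)%R else x j.

Definition fireable (m : nat) (x : height) (i : nat) : bool :=
  [&& letter m i, (1 < i) ==> (x i < x i.-1)%R & (i < m) ==> (x i < x i.+1)%R].

Fixpoint legal (m : nat) (d x : height) (w : word) : bool :=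
  if w is i :: w' then fireable m x i && legal m d (fire d i x) w' else true.

Definition leads (m : nat) (d x y : height) (w : word) : Prop :=
  legal m d x w /\
  forall i, letter m i -> y i = (x i + d i * (count_mem i w)%:Z)%R.

Lemma fireableP m x i : reflect
  (letter m i /\ forall j, letter m j -> adjacent i j -> (x i < x j)%R)
  (fireable m x i).
Proof.
apply: (iffP and3P) => [[mi hl hr]|[mi h]].
  split=> // j mj /orP[]/eqP ji.
    by rewrite ji; apply: (implyP hr); move: mj; rewrite ji; case/andP.
  by rewrite ji in hl *; apply: (implyP hl); case/andP: mj.
split=> //; apply/implyP=> hi; apply: h; move: mi hi; rewrite /letter /adjacent; lia.
Qed.

Lemma fireable_letter m x i : fireable m x i -> letter m i.
Proof. by case/and3P. Qed.

Lemma fireable_ext m x x' i : (forall j, letter m j -> x j = x' j) ->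
  fireable m x i = fireable m x' i.
Proof.
move=> xx'; apply/fireableP/fireableP => -[mi h]; split=> // j mj ij.
  by rewrite -!xx' //; apply: h.
by rewrite !xx' //; apply: h.
Qed.

Lemma legal_ext m d x x' w : (forall j, letter m j -> x j = x' j) ->
  legal m d x w = legal m d x' w.
Proof.
elim: w x x' => //= i w IH x x' xx'; rewrite (@fireable_ext m x x') //.
by rewrite (IH _ (fire d i x')) // => j mj; rewrite /fire xx'.
Qed.

Lemma legal_letter m d x w : legal m d x w -> word_in m w.
Proof.
by elim: w x => //= i w IH x /andP[/fireable_letter -> /IH].
Qed.

Lemma legal_cat m d x u v : legal m d x (u ++ v) =
  legal m d x u && legal m d (foldl (fun y i => fire d i y) x u) v.
Proof. by elim: u x => //= i u IH x; rewrite IH andbA. Qed.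

Lemma foldl_fire d x u i :
  foldl (fun y j => fire d j y) x u i = (x i + d i * (count_mem i u)%:Z)%R.
Proof.
elim: u x => [|j u IH] x /=; first by rewrite mulr0 addr0.
rewrite IH /fire (eq_sym j); case: eqP => // _; rewrite PoszD mulrDr mulr1; ring.
Qed.

Lemma legal_shift m d x c w :
  legal m d (fun i => (x i + c)%R) w = legal m d x w.
Proof.
elim: w x => //= i w IH x; rewrite -(IH (fire d i x)); congr (_ && _).
  by rewrite /fireable !ltrD2r.
apply: legal_ext => j _; rewrite /fire; case: eqP => // _; ring.
Qed.

Lemma legal_swap m d x u i j : (i.+1 < j) || (j.+1 < i) ->
  legal m d x [:: i, j & u] = legal m d x [:: j, i & u].
Proof.
move=> ij /=.
have fE a b y : (a.+1 < b) || (b.+1 < a) ->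
    fireable m (fire d a y) b = fireable m y b.
  move=> ab; rewrite /fireable /fire.
  by rewrite !ifF //; apply/negbTE; lia.
rewrite (fE i j) // (fE j i) 1?orbC // andbCA; congr [&& _, _ & _].
apply: legal_ext => k _; rewrite /fire.
by case: (eqVneq k j) => [->|_]; case: (eqVneq _ i).
Qed.

Lemma legal_comm m d x v w : comm_eq v w -> legal m d x v = legal m d x w.
Proof.
elim=> // [p q i j ij|w1 w2 w3 _ -> _ //].
by rewrite !legal_cat (@legal_swap _ _ _ _ i j).
Qed.

Lemma leads_comm m d x y v w :
  comm_eq v w -> leads m d x y v -> leads m d x y w.
Proof.
move=> vw [lv cv]; split; first by rewrite -(legal_comm m d x vw).
by move=> i mi; rewrite (cv i mi) (permP (comm_perm vw)).
Qed.

(** Before a fireable letter [i] is fired its neighbours stay above it, hence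
they cannot be fired. *)
Lemma legal_front m d x i w :
  fireable m x i -> legal m d x w -> i \in w -> comm_eq w (i :: rem i w).
Proof.
move=> fi lw iw; apply: comm_front => // j.
elim: w x fi lw {iw} => //= k w IH x fi /andP[fk lw].
case: (eqVneq k i) => //= ki; rewrite inE => /orP[/eqP-> | jw]; last first.
  apply: (IH (fire d k x)) jw => //.
  case/fireableP: fi => mi hi; apply/fireableP; split=> // l ml il.
  rewrite /fire eq_sym (negPf ki); case: eqP => [lk|_]; last exact: hi.
  case/fireableP: fk => mk hk; have := hk i mi; rewrite -lk adjacent_sym => /(_ il).
  by have := hi l ml il; lia.
apply/negP => ik; case/fireableP: fi => mi hi; case/fireableP: fk => mk hk.
have := hi k mk ik; have := hk i mi; rewrite adjacent_sym => /(_ ik); lia.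
Qed.

(** The end points fix the number of occurrences of each letter. So the first
letter of one sequence occurs in the other one, where it can be brought to the
front; the argument is then repeated with the remaining letters. *)
Lemma leads_uniq m d x y v w : (forall i, (0 < d i)%R) ->
  leads m d x y v -> leads m d x y w -> comm_eq v w.
Proof.
move=> d0; elim: v x w => [|i v IH] x w [lv cv] [lw cw].
  case: w lw cw => [|j w] lw cw; first exact: comm_refl.
  have mj : letter m j by case/andP: lw => /fireable_letter.
  have := cw j mj; rewrite cv //= eqxx; have := d0 j; nia.
case/andP: (lv) => fi lv'; have mi := fireable_letter fi.
have iw : i \in w.
  rewrite -has_pred1 has_count; have := cw i mi; rewrite cv //= eqxx.
  have := d0 i; nia.
have wE := legal_front fi lw iw.
apply: comm_sym; apply: (comm_trans wE); apply: comm_cons; apply: comm_sym.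
apply: (IH (fire d i x)).
  split=> // j mj; rewrite cv //= /fire (eq_sym i); case: (eqVneq j i) => [->|_].
    by rewrite PoszD mulrDr mulr1 addrA.
  by rewrite /= add0n.
have /andP[_ lw'] : legal m d x (i :: rem i w).
  by rewrite -(legal_comm m d x wE).
split=> // j mj; rewrite cw // (permP (comm_perm wE)) /= /fire (eq_sym i).
case: (eqVneq j i) => [->|_]; first by rewrite PoszD mulrDr mulr1 addrA.
by rewrite /= add0n.
Qed.

Lemma leads_nil m d x y : (forall i, letter m i -> y i = x i) ->
  leads m d x y [::].
Proof. by move=> yx; split=> // i mi; rewrite yx //= mulr0 addr0. Qed.

Lemma leads_cons m d x y i w : leads m d x y (i :: w) <->
  fireable m x i /\ leads m d (fire d i x) y w.
Proof.
have cE j : (x j + d j * (count_mem j (i :: w))%:Z =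
             fire d i x j + d j * (count_mem j w)%:Z)%R.
  rewrite /fire /= (eq_sym i); case: (eqVneq j i) => [->|_].
    by rewrite PoszD mulrDr mulr1 addrA.
  by rewrite /= add0n.
split=> [[/= /andP[-> lw] h]|[fi [lw h]]].
  by split=> //; split=> // j mj; rewrite h // cE.
by split=> [|j mj]; rewrite ?h ?cE //=; apply/andP.
Qed.

Lemma leads_ext m d x y x' y' w :
  (forall i, letter m i -> x i = x' i) -> (forall i, letter m i -> y i = y' i) ->
  leads m d x y w -> leads m d x' y' w.
Proof.
move=> xx yy [lw h]; split; first by rewrite -(legal_ext d w xx).
by move=> i mi; rewrite -yy // -xx // h.
Qed.

Lemma leads_cat m d x y z u v :
  leads m d x y u -> leads m d y z v -> leads m d x z (u ++ v).
Proof.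
move=> [lu hu] [lv hv]; split.
  rewrite legal_cat lu /= (@legal_ext m d _ y) // => i mi.
  by rewrite foldl_fire hu.
move=> i mi; rewrite hv // hu // count_cat PoszD; ring.
Qed.

Lemma leads_shift m d x y c w : leads m d x y w ->
  leads m d (fun i => (x i + c)%R) (fun i => (y i + c)%R) w.
Proof.
case=> lw h; split; first by rewrite legal_shift.
by move=> i mi; rewrite h //; ring.
Qed.

Lemma star_letter m i : letter m i -> letter m (star m i).
Proof. rewrite /letter /star; lia. Qed.

Lemma starK m i : letter m i -> star m (star m i) = i.
Proof. rewrite /letter /star; lia. Qed.

Lemma star_adj m i j : letter m i -> letter m j ->
  adjacent (star m i) (star m j) = adjacent i j.
Proof. rewrite /letter /star /adjacent => mi mj; apply/idP/idP; lia. Qed.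

Lemma fireable_star m x i : letter m i ->
  fireable m (x \o star m) (star m i) = fireable m x i.
Proof.
move=> mi; apply/fireableP/fireableP => -[mi' h]; (split; first by
  [|exact: star_letter]) => j mj ij.
  have := h (star m j) (star_letter mj); rewrite star_adj //= !starK //; exact.
rewrite /= starK //; apply: h; first exact: star_letter.
by rewrite -(@star_adj m) ?starK //; exact: star_letter.
Qed.

Lemma leads_star m d x y w : (forall i, letter m i -> d (star m i) = d i) ->
  leads m d x y w ->
  leads m d (x \o star m) (y \o star m) (map (star m) w).
Proof.
move=> ds; elim: w x => [|i w IH] x.
  case=> _ h; apply: leads_nil => i mi /=; rewrite h ?mulr0 ?addr0 //=.
  exact: star_letter.
case/leads_cons=> fi h; have mi := fireable_letter fi.
apply/leads_cons; split; first by rewrite fireable_star.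
apply: leads_ext (IH _ h) => // j mj; rewrite /fire /=.
rewrite (_ : (star m j == i) = (j == star m i)) ?ds //.
apply/eqP/eqP => [<-|->]; by rewrite starK.
Qed.

(** This is how relative heights are recovered from a word: of two
neighbouring letters the lower one is fired first. *)
Lemma legal_index m d x w i j : letter m i -> letter m j -> adjacent i j ->
  (x i < x j)%R -> legal m d x w -> j \in w -> index i w < index j w.
Proof.
move=> mi mj ij; elim: w x => //= k w IH x xij /andP[fk lw].
case: (eqVneq k i) => [->|ki]; first by case: eqP xij => // ->; rewrite ltxx.
case: (eqVneq k j) => [kj|kj].
  case/fireableP: fk => _ /(_ i mi); rewrite kj adjacent_sym ij => /(_ isT); lia.
rewrite inE eq_sym (negPf kj) ltnS; apply: IH lw.
by rewrite /fire !(eq_sym _ k) (negPf ki) (negPf kj).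
Qed.

(** * Words as permutations *)

Definition swap (i x : nat) : nat :=
  if x == i then i.+1 else if x == i.+1 then i else x.

Definition act (w : word) (x : nat) : nat := foldr swap x w.

Lemma swapK i : involutive (swap i).
Proof. by move=> x; rewrite /swap; do !case: eqP => //=; lia. Qed.

Lemma swap_letter m i x : letter m i -> letter m.+1 (swap i x) = letter m.+1 x.
Proof. by rewrite /letter /swap; do !case: eqP => //=; lia. Qed.

Lemma act_cat u v x : act (u ++ v) x = act u (act v x).
Proof. exact: foldr_cat. Qed.

(** The prefixes of a word act last. Appending [i] exchanges the values at [i] and
[i+1], which is the form used for columns and for inversions. *)
Lemma act_rcons w i x : act (rcons w i) x = act w (swap i x).
Proof. by rewrite -cats1 act_cat. Qed.

Lemma actK w : cancel (act w) (act (rev w)).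
Proof. by elim: w => //= i w IH x; rewrite rev_cons act_rcons swapK IH. Qed.

Lemma actVK w : cancel (act (rev w)) (act w).
Proof. by move=> x; rewrite -{1}(revK w) actK. Qed.

Lemma act_inj w : injective (act w).
Proof. exact: can_inj (actK w). Qed.

Lemma act_letter m w x : word_in m w ->
  letter m.+1 (act w x) = letter m.+1 x.
Proof. by elim: w => //= i w IH /andP[mi /IH <-]; rewrite swap_letter. Qed.

Lemma word_in_rev m w : word_in m (rev w) = word_in m w.
Proof. exact: all_rev. Qed.

Lemma word_in_rcons m w i : word_in m (rcons w i) = letter m i && word_in m w.
Proof. exact: all_rcons. Qed.

Lemma act_comm v w : comm_eq v w -> act v =1 act w.
Proof.
elim=> [{}w//|p q i j ij|w1 w2 w3 _ h12 _ h23] x; last by rewrite h12 h23.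
rewrite !act_cat /=; congr (act p _); move: (act q x) => {}x.
by rewrite /swap; do !case: eqP => //=; lia.
Qed.

Lemma word_mx_rcons m w i :
  word_mx m (rcons w i) = (word_mx m w *m simple_refl m i)%R.
Proof.
rewrite /word_mx; elim: w => [|j w IH];
  last by rewrite rcons_cons !big_cons IH mulmxA.
by rewrite /= big_cons !big_nil mulmx1 mul1mx.
Qed.

(** In the coordinates of the simple roots, [e_a - e_b] has [k]-th coordinate
[[a <= k] - [b <= k]]; the column [j] of the matrix of [w] is the image of
[e_j - e_{j+1}]. *)
Lemma word_mxE m w (k j : 'I_m) : word_in m w -> word_mx m w k j =
  ((act w j.+1 <= k.+1)%:R - (act w j.+2 <= k.+1)%:R)%R.
Proof.
elim/last_ind: w k j => [|w i IH] k j.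
  move=> _; rewrite /word_mx big_nil mxE /= -val_eqE /= !ltnS.
  by case: ltngtP => kj; rewrite ?subrr ?subr0.
rewrite word_in_rcons => /andP[mi mw]; rewrite word_mx_rcons mxE !act_rcons.
have i1 : i.-1 < m by move: mi; rewrite /letter; lia.
have iE : i.-1.+1 = i by move: mi; rewrite /letter; lia.
under eq_bigr => l _ do rewrite mxE mulrBr.
rewrite big_split /= (bigD1 j) //= eqxx mulr1 big1 ?addr0; last first.
  by move=> l /negPf ->; rewrite mulr0.
rewrite (bigD1 (Ordinal i1)) //= iE eqxx mul1r big1 ?addr0; last first.
  move=> l; rewrite -val_eqE /= => li.
  by rewrite (_ : l.+1 == i = false) ?mul0r ?mulr0 ?oppr0 //; apply/negP; lia.
rewrite !IH //= iE /cartan /adjacent /swap.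
have [f fE] : exists f : nat -> rat, forall x, ((act w x <= k.+1)%:R = f x)%R.
  by eexists.
rewrite !fE; have [e|/eqP h1] := eqVneq i j.+1.
  by rewrite e !eqxx ifN ?fE; [ring | lia].
have [e|/eqP h2] := eqVneq i j.
  by rewrite e !eqxx /= !ifN ?fE; [ring | lia ..].
have [e|/eqP h3] := eqVneq i j.+2.
  by rewrite e orbT !ifN ?fE; [ring | lia ..].
by rewrite orbF !ifN ?fE; [ring | lia ..].
Qed.

(** The columns give [e_{w(j)} - e_{w(j+1)}] for all [j], hence all
[e_{w(x)} - e_{w(y)}]; the common shift left undetermined is zero because
both permutations reach the last point. *)
Lemma word_mx_act m v w : word_in m v -> word_in m w ->
  (word_mx m v = word_mx m w <->
   forall x, letter m.+1 x -> act v x = act w x).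
Proof.
move=> mv mw; split=> [vw|vw]; last first.
  apply/matrixP => k j; rewrite !word_mxE // !vw //;
    by move: (ltn_ord j); rewrite /letter; lia.
have step t x : letter m t -> letter m x ->
    ((act v x <= t)%:R - (act w x <= t)%:R =
     (act v x.+1 <= t)%:R - (act w x.+1 <= t)%:R :> rat)%R.
  move=> mt mx; have t1 : t.-1 < m by move: mt; rewrite /letter; lia.
  have x1 : x.-1 < m by move: mx; rewrite /letter; lia.
  have := congr1 (fun A : 'M_m => A (Ordinal t1) (Ordinal x1)) vw.
  rewrite !word_mxE //= !prednK; [lra | by move: mx mt; rewrite /letter; lia ..].
have const t x y : letter m t -> letter m.+1 x -> letter m.+1 y ->
    ((act v x <= t)%:R - (act w x <= t)%:R =
     (act v y <= t)%:R - (act w y <= t)%:R :> rat)%R.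
  move=> mt; suff h z : letter m.+1 z -> ((act v z <= t)%:R - (act w z <= t)%:R =
     (act v 1 <= t)%:R - (act w 1 <= t)%:R :> rat)%R by move=> mx my; rewrite !h.
  elim: z => // z IH mz; case: (posnP z) => [->//|z0].
  rewrite -step // ?IH //; move: mz; rewrite /letter; lia.
have le t x : letter m t -> letter m.+1 x -> (act v x <= t) = (act w x <= t).
  move=> mt mx.
  have last u : word_in m u -> exists2 y, letter m.+1 y & (act u y <= t) = false.
    move=> mu; exists (act (rev u) m.+1); last by rewrite actVK; move: mt;
      rewrite /letter; lia.
    by rewrite act_letter ?word_in_rev // /letter leqnn.
  have [y my yv] := last v mv; have [z mz zw] := last w mw.
  have := const t x y mt mx my; have := const t x z mt mx mz.
  rewrite yv zw; do !case: (_ <= t) => //=; lra.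
move=> x mx; have := act_letter x mv; have := act_letter x mw; rewrite mx.
move=> ax bx; case: (ltngtP (act v x) (act w x)) => // h.
- have : (act v x <= act v x) = (act w x <= act v x); last by lia.
  by apply: le => //; move: ax bx h; rewrite /letter; lia.
- have : (act v x <= act w x) = (act w x <= act w x); last by lia.
  by apply: le => //; move: ax bx h; rewrite /letter; lia.
Qed.

(** * Inversions and the longest element *)

Definition inversions (m : nat) (f : nat -> nat) : nat :=
  \sum_(a <- iota 1 m.+1) \sum_(b <- iota 1 m.+1) ((a < b) && (f b < f a)).

Lemma mem_iota1 m x : (x \in iota 1 m) = letter m x.
Proof. by rewrite mem_iota /letter; lia. Qed.

Lemma inversions_ext m f g : (forall x, letter m.+1 x -> f x = g x) ->
  inversions m f = inversions m g.
Proof.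
move=> fg; apply: eq_big_seq => a; rewrite mem_iota1 => ma.
by apply: eq_big_seq => b; rewrite mem_iota1 => mb; rewrite !fg.
Qed.

Lemma sum_swap m i (F : nat -> nat) : letter m i ->
  \sum_(a <- iota 1 m.+1) F (swap i a) = \sum_(a <- iota 1 m.+1) F a.
Proof.
move=> mi; rewrite -(big_map (swap i) predT F); apply: perm_big; apply: uniq_perm.
- by rewrite map_inj_uniq ?iota_uniq //; exact: can_inj (swapK i).
- exact: iota_uniq.
- move=> x; rewrite -{1}(swapK i x) mem_map; last exact: can_inj (swapK i).
  by rewrite !mem_iota1 swap_letter.
Qed.

Lemma sum_pick (s : seq nat) c (F : nat -> nat) : uniq s -> c \in s ->
  \sum_(a <- s) (a == c) * F a = F c.
Proof.
move=> us cs; rewrite (bigD1_seq c) //= eqxx mul1n big1 ?addn0 // => a /negPf ->.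
by rewrite mul0n.
Qed.

(** Exchanging the values at [i] and [i+1] reindexes the pairs, except that
the order of the pair [(i, i+1)] itself is reversed. *)
Lemma inversions_swap m i f : letter m i ->
  inversions m (f \o swap i) + (f i.+1 < f i) = inversions m f + (f i < f i.+1).
Proof.
move=> mi.
pose S (G : nat -> nat -> nat) :=
  \sum_(a <- iota 1 m.+1) \sum_(b <- iota 1 m.+1) G a b.
have mi1 : i.+1 \in iota 1 m.+1 by rewrite mem_iota1; move: mi; rewrite /letter; lia.
have mi0 : i \in iota 1 m.+1 by rewrite mem_iota1; move: mi; rewrite /letter; lia.
have pick c d : c \in iota 1 m.+1 -> d \in iota 1 m.+1 ->
    S (fun a b => (a == c) * ((b == d) * (f b < f a))) = (f d < f c).
  move=> hc hd; rewrite /S; under eq_bigr => a _ do rewrite -big_distrr /=.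
  by rewrite (sum_pick _ (iota_uniq _ _) hc) (sum_pick (fun b =>
    f b < f c) (iota_uniq _ _) hd).
have -> : inversions m (f \o swap i) =
    S (fun a b => (swap i a < swap i b) && (f b < f a)).
  rewrite /S -[RHS](sum_swap _ mi); apply: eq_bigr => a _.
  by rewrite -[RHS](sum_swap _ mi); apply: eq_bigr => b _; rewrite !swapK.
rewrite -(pick i i.+1) // -(pick i.+1 i) //.
rewrite /inversions /S -!big_split; apply: eq_bigr => a _.
rewrite -!big_split; apply: eq_bigr => b _ /=.
by rewrite /swap; case: (f b < f a); do !case: eqP => /= *; lia.
Qed.

Lemma inversions_id m : inversions m id = 0.
Proof. by rewrite /inversions big1 // => a _; rewrite big1 // => b _;
  case: ltngtP. Qed.

Lemma inversions_le_size m w : word_in m w -> inversions m (act w) <= size w.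
Proof.
elim/last_ind: w => [|w i IH]; first by rewrite (_ : act [::] = id) ?inversions_id.
rewrite word_in_rcons => /andP[mi /IH]; rewrite size_rcons.
have := inversions_swap (act w) mi.
rewrite (_ : act (rcons w i) = act w \o swap i); last by apply: funext => x;
  rewrite act_rcons.
lia.
Qed.

Lemma increasing_id k f : (forall x, letter k x -> letter k (f x)) ->
  (forall i, letter k i -> letter k i.+1 -> f i < f i.+1) ->
  forall x, letter k x -> f x = x.
Proof.
move=> fk incr x kx.
have lo y : letter k y -> y <= f y.
  elim: y => // y IH ky; case: (posnP y) => [e|y0].
    by have := fk _ ky; rewrite e /letter; lia.
  have ky' : letter k y by move: ky; rewrite /letter; lia.
  by have := IH ky'; have := incr y ky' ky; lia.
have hi j : forall y, y + j = k -> letter k y -> f y <= y.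
  elim: j => [|j IH] y yj ky; first by have := fk _ ky; rewrite /letter; lia.
  have ky' : letter k y.+1 by move: ky; rewrite /letter; lia.
  by have := IH y.+1; have := incr y ky ky'; rewrite ky'; lia.
have := lo x kx; have := hi (k - x) x; rewrite kx; move: kx; rewrite /letter; lia.
Qed.

(** Bubble sort: as long as some [i] is a descent, appending [i] removes one
inversion; without descents the permutation is the identity. *)
Lemma short_word m w : word_in m w -> exists w',
  [/\ word_in m w', forall x, letter m.+1 x -> act w' x = act w x &
      size w' = inversions m (act w)].
Proof.
have [k] := ubnP (inversions m (act w)); elim: k w => // k IH w;
  rewrite ltnS => wk mw.
have [[i [mi desc]]|asc] :=
  pselect (exists i, letter m i /\ act w i.+1 < act w i).
  have := inversions_swap (act w) mi.
  rewrite (_ : _ \o _ = act (rcons w i)); last by apply: funext => x;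
    rewrite act_rcons.
  rewrite desc ltnNge (ltnW desc) => wi.
  have [||w' [mw' w'w sw']] := IH (rcons w i); first by lia.
    by rewrite word_in_rcons mi.
  exists (rcons w' i); split; first by rewrite word_in_rcons mi.
    by move=> x mx; rewrite act_rcons w'w ?swap_letter // act_rcons swapK.
  by rewrite size_rcons sw'; lia.
have wid x : letter m.+1 x -> act w x = x.
  apply: increasing_id x => [x|i mi mi1]; first by rewrite act_letter.
  rewrite ltnNge leq_eqVlt (inj_eq (@act_inj w)) gtn_eqF //=.
  apply/negP => h; apply: asc; exists i; split=> //.
  by move: mi mi1; rewrite /letter; lia.
exists [::]; split=> // [x mx|]; first by rewrite wid.
by rewrite (@inversions_ext m _ id) ?inversions_id.
Qed.

Lemma sum_pairs k :
  \sum_(a <- iota 1 k) \sum_(b <- iota 1 k) (a < b) = 'C(k, 2).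
Proof.
elim: k => [|k IH]; first by rewrite big_nil.
have -> : iota 1 k.+1 = rcons (iota 1 k) k.+1 by rewrite -cats1 -{1}[k.+1]addn1 iotaD add1n.
rewrite binS bin1 -IH big_rcons /= [X in _ + X]big1_seq ?addn0; last first.
  by move=> b; rewrite mem_rcons inE mem_iota1 /letter; lia.
under eq_bigr => a _ do rewrite big_rcons /=.
rewrite big_split /=; congr addn; rewrite (@eq_big_seq _ _ _ _ _ _ (fun=> 1));
  last first.
  by move=> a; rewrite mem_iota1 /letter; lia.
by rewrite sum1_size size_iota.
Qed.

Lemma inversions_le m f : inversions m f <= 'C(m.+1, 2).
Proof.
rewrite -sum_pairs; apply: leq_sum => a _; apply: leq_sum => b _.
by case: (a < b); case: (f b < f a).
Qed.

Lemma sum_ltn (s : seq nat) c (F G : nat -> nat) : uniq s -> c \in s ->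
  (forall a, a \in s -> F a <= G a) -> F c < G c -> \sum_(a <- s) F a < \sum_(a <- s) G a.
Proof.
move=> us cs FG FGc; rewrite (bigD1_seq c) //= [X in _ < X](bigD1_seq c) //=.
rewrite -addSn leq_add // big_seq_cond [X in _ <= X]big_seq_cond leq_sum // => a.
by case/andP=> /FG.
Qed.

(** The longest element exchanges [x] and [m+2-x]. *)
Definition reverses (m : nat) (w : word) : Prop :=
  forall x, letter m.+1 x -> act w x = star m.+1 x.

Lemma inversions_rev m w : reverses m w -> inversions m (act w) = 'C(m.+1, 2).
Proof.
move=> rw; rewrite -sum_pairs; apply: eq_big_seq => a; rewrite mem_iota1 => ma.
apply: eq_big_seq => b; rewrite mem_iota1 => mb; rewrite !rw //.
by move: ma mb; rewrite /letter /star; lia.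
Qed.

Lemma rev_inversions m w : word_in m w ->
  inversions m (act w) = 'C(m.+1, 2) -> reverses m w.
Proof.
move=> mw wC.
have dec a b : letter m.+1 a -> letter m.+1 b -> a < b -> act w b < act w a.
  move=> ma mb ab; rewrite ltnNge leq_eqVlt (inj_eq (@act_inj w)) ltn_eqF //=.
  apply/negP => h; suff : inversions m (act w) < 'C(m.+1, 2) by rewrite wC ltnn.
  have le c e : (c < e) && (act w e < act w c) <= (c < e).
    by case: (c < e); case: (_ < _).
  rewrite -sum_pairs; apply: (@sum_ltn _ a); rewrite ?iota_uniq ?mem_iota1 //.
    by move=> c _; apply: leq_sum => e _; exact: le.
  apply: (@sum_ltn _ b); rewrite ?iota_uniq ?mem_iota1 //.
  by move: h ab; lia.
move=> x mx; have := @increasing_id m.+1 (act w \o star m.+1).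
move=> /(_ _ _ (star m.+1 x) (star_letter mx)) /=; rewrite starK //; apply.
  by move=> y my; rewrite act_letter //; exact: star_letter.
move=> i mi mi1; apply: dec; rewrite ?star_letter //.
by move: mi mi1; rewrite /letter /star; lia.
Qed.

(** Sorting gives a word whose length is the number of inversions, and no word is
shorter because each letter creates at most one inversion. *)
Lemma reducedP m w :
  reduced m w <-> word_in m w /\ size w = inversions m (act w).
Proof.
split=> [[mw h]|[mw h]]; split=> //.
  apply/eqP; rewrite eqn_leq inversions_le_size // andbT.
  have [w' [mw' w'w <-]] := short_word mw; apply: h => //.
  exact/word_mx_act.
move=> w' mw' /word_mx_act w'w; rewrite h -(@inversions_ext m (act w')).
  exact: inversions_le_size.
exact: w'w.
Qed.

Lemma reverses_reduced m w : word_in m w -> reverses m w ->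
  size w = 'C(m.+1, 2) -> reduced_w0 m w.
Proof.
move=> mw rw sw; split; first by apply/reducedP; rewrite inversions_rev.
split; first by exists w.
move=> v v' /reducedP[mv ->] /reducedP[mv' ->] /(word_mx_act mv mw) vw.
by rewrite (inversions_ext vw) (inversions_rev rw) inversions_le.
Qed.

(** An element of maximal length inverts every pair, which leaves only the
reversal; its maximality is tested against [v]. *)
Lemma reduced_reverses m v w : reduced_w0 m v -> reverses m v ->
  reduced_w0 m w -> reverses m w /\ size w = 'C(m.+1, 2).
Proof.
move=> [rv _] revv [rw [_ longw]]; have /reducedP[mw sw] := rw.
have /reducedP[_ sv] := rv; have := longw w v rw rv erefl.
rewrite sv (inversions_rev revv) sw => h.
have e : inversions m (act w) = 'C(m.+1, 2) by have := inversions_le m (act w); lia.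
by split=> //; exact: rev_inversions.
Qed.

(** * Zigzag heights and wiring phases *)

(** Orientations of the diagram of type [A_m] are encoded, up to a common
translation, by heights in which neighbours differ by 2. Firing raises a sink
by 4, that is from 2 below to 2 above its neighbours. *)
Definition zigzag (m : nat) (x : height) : Prop :=
  forall i, letter m i -> letter m i.+1 ->
    (x i.+1 = x i + 2 \/ x i.+1 = x i - 2)%R.

Definition step4 : height := fun=> 4%Z.

Lemma fireableS m x i : fireable m x i -> letter m i.+1 -> (x i < x i.+1)%R.
Proof. by case/fireableP=> _ h mi1; apply: h => //; rewrite /adjacent eqxx. Qed.

Lemma fireableP1 m x i : fireable m x i -> letter m i.-1 -> (x i < x i.-1)%R.
Proof.
case/fireableP=> mi h mi1; apply: h => //.
by move: mi mi1; rewrite /adjacent /letter; lia.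
Qed.

Lemma zigzag_fire m x i : zigzag m x -> fireable m x i ->
  zigzag m (fire step4 i x).
Proof.
move=> zx fi j mj mj1; have := zx j mj mj1; rewrite /fire /step4.
case: (eqVneq j i) => [e|ji].
  rewrite ifF; last by apply/eqP; lia.
  by have := fireableS fi; rewrite -e => /(_ mj1); lia.
case: (eqVneq j.+1 i) => [e|_] //.
by have := fireableP1 fi; rewrite -e /= => /(_ mj); lia.
Qed.

Lemma zigzag_ext m x y : (forall i, letter m i -> y i = x i) ->
  zigzag m x -> zigzag m y.
Proof. by move=> yx zx i mi mi1; rewrite !yx //; exact: zx. Qed.

Lemma zigzag_leads m x y w : zigzag m x -> leads m step4 x y w -> zigzag m y.
Proof.
elim: w x => [|i w IH] x zx.
  by case=> _ h; apply: zigzag_ext zx => i mi; rewrite h //= mulr0 addr0.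
by case/leads_cons=> fi; apply: IH; exact: zigzag_fire.
Qed.

Lemma zigzag_bound m x i j : zigzag m x -> letter m i -> letter m j -> i <= j ->
  (x j - x i <= 2 * (j%:Z - i%:Z) /\ x i - x j <= 2 * (j%:Z - i%:Z))%R.
Proof.
move=> zx mi; elim: j => [|j IH] mj ij; first by move: mi; rewrite /letter; lia.
case: (eqVneq i j.+1) => [<-|ne]; first by lia.
have mj' : letter m j by move: mi mj; rewrite /letter; lia.
by have := IH mj'; have := zx j mj' mj; lia.
Qed.

Lemma zigzag_mod4 m x i j : zigzag m x -> letter m i -> letter m j ->
  exists k : int, (x j = x i + 2 * (j%:Z - i%:Z) + k * 4)%R.
Proof.
move=> zx; suff h i' j' : letter m i' -> letter m j' -> i' <= j' ->
    exists k : int, (x j' = x i' + 2 * (j'%:Z - i'%:Z) + k * 4)%R.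
  move=> mi mj; case: (leqP i j) => [|/ltnW] ij; first exact: h.
  by have [k e] := h j i mj mi ij; exists (- k)%R; lia.
move=> mi; elim: j' => [|a IH] ma ia; first by move: mi; rewrite /letter; lia.
case: (eqVneq i' a.+1) => [<-|ne]; first by exists 0%R; lia.
have ma' : letter m a by move: mi ma; rewrite /letter; lia.
have [|k e] := IH ma'; first by lia.
by case: (zx a ma' ma) => e'; [exists k | exists (k - 1)%R]; lia.
Qed.

Definition eqmod (M a b : int) : Prop := exists k : int, (a = b + k * M)%R.

Lemma eqmod_trans M b a c : eqmod M a b -> eqmod M b c -> eqmod M a c.
Proof. by move=> [k ->] [l ->]; exists (k + l)%R; ring. Qed.

Lemma eqmod_sym M a b : eqmod M a b -> eqmod M b a.
Proof. by move=> [k ->]; exists (- k)%R; ring. Qed.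

Lemma eqmod_refl M a : eqmod M a a.
Proof. by exists 0%R; ring. Qed.

Lemma eqmod_small M a b : (`|a - b| < M)%R -> eqmod M a b -> a = b.
Proof.
move=> h [k e]; case: (eqVneq k 0%R) => [k0|k0]; first by rewrite e k0; ring.
by have : (M <= `|k * M|)%R; [rewrite normrM; nia | move: h; rewrite e; lia].
Qed.

(** In the wiring diagram of a word the letter [i] crosses the wires at the
positions [i] and [i+1]; place this crossing at the point [(i, h)] when [i] is
fired at height [h]. Each wire then runs along lines of slope 2 and -2 and is
reflected at the two borders. The phase is the intercept of the line on which
the wire at position [p] goes on, unfolded at the borders: it depends on the
wire only, up to the period [4 (m+1)]. *)
Definition phase (m : nat) (x : height) (p : nat) : int :=
  if (p == 1) || (p <= m) && (x p < x p.-1)%R then (x p - 2 * p%:Z)%R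
  else (x p.-1 + 2 * p.-1%:Z)%R.

Definition period (m : nat) : int := (4 * m.+1%:Z)%R.

Lemma phase_ext m x y p : letter m.+1 p -> 0 < m ->
  (forall i, letter m i -> y i = x i) -> phase m y p = phase m x p.
Proof.
move=> mp m0 yx; rewrite /phase; case: (eqVneq p 1) => [->|p1] /=.
  by rewrite yx // /letter m0.
have -> : y p.-1 = x p.-1 by apply: yx; move: mp p1; rewrite /letter; lia.
by case: leqP => //= pm; rewrite yx //; move: mp; rewrite /letter; lia.
Qed.

(** Only the two wires that cross change their positions, and no wire changes its
phase; the period appears when a wire is reflected at the last position. *)
Lemma phase_fire m x i p : zigzag m x -> fireable m x i -> letter m.+1 p ->
  eqmod (period m) (phase m (fire step4 i x) p) (phase m x (swap i p)).
Proof.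
move=> zx fi mp; have mi := fireable_letter fi.
have up : letter m i.+1 -> x i.+1 = (x i + 2)%R.
  by move=> mi1; have := zx i mi mi1; have := fireableS fi mi1; lia.
have down : letter m i.-1 -> x i.-1 = (x i + 2)%R.
  move=> mi1; have := fireableP1 fi mi1.
  have := zx i.-1 mi1; rewrite (_ : i.-1.+1 = i); last by move: mi;
    rewrite /letter; lia.
  by move=> /(_ mi); lia.
rewrite /phase /swap /fire /step4 /period.
case: (eqVneq p i) => [->|pi].
  have -> : (i.-1 == i) = false by move: mi; rewrite /letter; lia.
  have -> : (i.+1 == 1) = false by move: mi; rewrite /letter; lia.
  have -> : (i.+1 <= m) && (x i.+1 < x i.+1.-1)%R = false.
    by apply/negP => /andP[im] /=; rewrite up ?/letter //; lia.
  case: (eqVneq i 1) => [->|i1] /=; first by exists 0%R; lia.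
  rewrite down; last by move: mi i1; rewrite /letter; lia.
  have -> : (i <= m) && (x i + 4 < x i + 2)%R = false by lia.
  by exists 0%R; move: mi; rewrite /letter; lia.
case: (eqVneq p i.+1) => [->|pi1] /=.
  have -> : (i.+1 == 1) = false by move: mi; rewrite /letter; lia.
  rewrite eqxx /=.
  have -> : (i == 1) || (i <= m) && (x i < x i.-1)%R = true.
    case: (eqVneq i 1) => //= i1; rewrite down; move: mi i1; rewrite /letter; lia.
  case: (leqP i.+1 m) => im /=.
    by rewrite up ?/letter // ifT; [exists 0%R; lia | lia].
  by exists 1%R; move: mi; rewrite /letter; lia.
by have -> : (p.-1 == i) = false; [move: pi1 mp mi; rewrite /letter;
  lia | exact: eqmod_refl].
Qed.

Lemma phase_leads m x y w p : zigzag m x -> leads m step4 x y w ->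
  0 < m -> letter m.+1 p -> eqmod (period m) (phase m y p) (phase m x (act w p)).
Proof.
move=> + + m0 mp; elim: w x => [|i w IH] x zx.
  case=> _ h; rewrite (@phase_ext m x) //=; first exact: eqmod_refl.
  by move=> i mi; rewrite h //= mulr0 addr0.
case/leads_cons=> fi h /=; apply: eqmod_trans (IH _ (zigzag_fire zx fi) h) _.
by apply: phase_fire => //; rewrite act_letter //; case: h => /legal_letter.
Qed.

(** On the lines of slope -2 the phases grow with the position, on those of slope
2 they decrease, the phases of the first kind are larger than those of the
second kind, and all of them fit into less than one period. *)
Lemma phase_inj m x p q : zigzag m x -> letter m.+1 p -> letter m.+1 q ->
  eqmod (period m) (phase m x p) (phase m x q) -> p = q.
Proof.
move=> zx.
suff h a b : letter m.+1 a -> letter m.+1 b -> a < b ->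
    ~ eqmod (period m) (phase m x a) (phase m x b).
  move=> mp mq pq; case: (ltngtP p q) => //= pq'.
    by have := h p q mp mq pq' pq.
  by have := h q p mq mp pq' (eqmod_sym pq).
move=> ma mb ab e.
have {e} : phase m x a != phase m x b -> (`|phase m x a - phase m x b| >= period m)%R.
  by move=> /eqP ne; rewrite leNgt; apply/negP => /eqmod_small /(_ e).
have bd i j : letter m i -> letter m j -> i <= j ->
  (x j - x i <= 2 * (j%:Z - i%:Z) /\ x i - x j <= 2 * (j%:Z - i%:Z))%R.
  exact: zigzag_bound.
have b1 : letter m b.-1 by move: ma mb; rewrite /letter; lia.
have [k1 k2] : b.-1.+1 = b /\ b != 1 by move: ma mb; rewrite /letter; lia.
rewrite /phase (negPf k2) /= /period.
have zb : b <= m -> (x b = x b.-1 + 2 \/ x b = x b.-1 - 2)%R.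
  by move=> bm; have := zx b.-1 b1; rewrite k1; apply; rewrite /letter; lia.
have la : letter m a by move: ma mb; rewrite /letter; lia.
have := bd a b.-1 la b1; rewrite -ltnS k1 => /(_ ab).
have mb' : letter m b.-1.+1 -> b.-1.+1 <= m by case/andP.
case: (eqVneq a 1) => [a1|a1] /=.
  by rewrite a1 in la *; case: ifP; move: ma mb; rewrite /letter; lia.
have la1 : letter m a.-1 by move: ma mb a1; rewrite /letter; lia.
have := bd a.-1 b.-1 la1 b1.
have := bd a.-1 a la1 la.
have := zx a.-1 la1; rewrite prednK; last by move: la; rewrite /letter; lia.
move=> /(_ la).
by do 2![case: ifP]; move: ma mb; rewrite /letter; lia.
Qed.

(** The mirror image exchanges the lines of slope 2 and -2; raising it by half a
period, [2 (m+1)], restores the phases. *)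
Lemma phase_star m x p : zigzag m x -> 0 < m -> letter m.+1 p ->
  eqmod (period m)
    (phase m (fun i => (x (star m i) + 2 * m.+1%:Z)%R) p) (phase m x (star m.+1 p)).
Proof.
move=> zx m0; rewrite /letter => mp; rewrite /phase /period.
case: (eqVneq p 1) => [->|p1] /=.
  have [-> ->] : star m.+1 1 = m.+1 /\ star m 1 = m by rewrite /star; lia.
  by rewrite ltnn /= eqSS (gtn_eqF m0) /=; exists 0%R; lia.
have [e1 e2] : (star m.+1 p).-1 = star m p /\ star m p.-1 = star m.+1 p.
  by rewrite /star; lia.
rewrite e1 e2.
case: (leqP p m) => pm /=; last first.
  rewrite (_ : star m.+1 p = 1) ?eqxx /=; last by rewrite /star; lia.
  by exists 1%R; lia.
have z : (x (star m.+1 p) = x (star m p) + 2 \/ x (star m.+1 p) = x (star m p) - 2)%R.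
  have := zx (star m p); rewrite (_ : (star m p).+1 = star m.+1 p);
    last by rewrite /star; lia.
  by apply; rewrite /letter /star; lia.
have -> : (star m.+1 p == 1) = false by rewrite /star; lia.
have -> : star m.+1 p <= m by rewrite /star; lia.
rewrite /=; case: ifP => h; case: ifP => h'; try lia.
  by exists 0%R; rewrite /star; lia.
by exists 1%R; rewrite /star; lia.
Qed.

(** If two heights agree up to [p-1] but not at [p <= m], then the wires at the
position [p] move in opposite directions, and their phases differ by [4 p],
which is less than a period. *)
Lemma phase_det m x y : zigzag m x -> zigzag m y -> 0 < m ->
  (forall p, letter m.+1 p -> eqmod (period m) (phase m y p) (phase m x p)) ->
  exists k : int, forall i, letter m i -> (y i = x i + k * period m)%R.
Proof.
move=> zx zy m0 h; have [k e1] : eqmod (period m) (y 1) (x 1).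
  have := h 1; rewrite /phase eqxx /= => /(_ isT) [k e]; exists k; lia.
exists k; elim=> // i IH mi; case: (posnP i) => [->//|i0].
have li : letter m i by move: mi; rewrite /letter; lia.
have ei := IH li; have := zx i li mi; have := zy i li mi.
have [|l] := h i.+1; first by move: mi; rewrite /letter; lia.
rewrite /phase /= eqSS (gtn_eqF i0) /=.
have -> : (i < m) = true by move: mi; rewrite /letter; lia.
rewrite /=; do 2![case: ifP]; try lia.
  move=> a b e f g; exfalso.
  have : eqmod (period m) (4 * i.+1%:Z)%R 0%R by exists (k - l)%R; lia.
  by move/eqmod_small; move: mi; rewrite /period /letter; lia.
move=> a b e f g; exfalso.
have : eqmod (period m) (4 * i.+1%:Z)%R 0%R by exists (l - k)%R; lia.
by move/eqmod_small; move: mi; rewrite /period /letter; lia.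
Qed.

Definition opposite (m : nat) (c : int) (x : height) : height :=
  fun i => (x (star m i) + c)%R.

Lemma sum_count m w : word_in m w ->
  \sum_(i <- iota 1 m) count_mem i w = size w.
Proof.
elim: w => [|j w IH] /=; first by rewrite big1.
case/andP=> mj /IH <-; rewrite big_split /= -[RHS]add1n; congr addn.
rewrite (eq_bigr (fun i => (i == j) * 1)) => [|i _]; last by rewrite muln1 eq_sym.
by rewrite (sum_pick (fun=> 1)) ?iota_uniq ?mem_iota1.
Qed.

(** Letters are counted together with their mirror images because the end points
of a firing sequence from a height to its mirror image determine these sums,
whatever the height. *)
Lemma double_size m w : word_in m w ->
  (size w).*2 = \sum_(i <- iota 1 m) (count_mem i w + count_mem (star m i) w).
Proof.
move=> mw; rewrite big_split /= -addnn -(sum_count mw); congr addn.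
rewrite -(big_map (star m) predT (fun i => count_mem i w)).
apply: perm_big; apply: uniq_perm; first exact: iota_uniq.
  rewrite map_inj_in_uniq ?iota_uniq // => i j; rewrite !mem_iota1 => mi mj h.
  by rewrite -(starK mi) h starK.
move=> i; rewrite mem_iota1; apply/idP/mapP => [mi|[j]]; last first.
  by rewrite mem_iota1 => mj ->; exact: star_letter.
by exists (star m i); [rewrite mem_iota1 star_letter | rewrite starK].
Qed.

(** The phases at the end are those of the mirror image, so the injectivity of
the phases identifies the permutation. *)
Lemma zigzag_reverses m x w : zigzag m x -> 0 < m ->
  leads m step4 x (opposite m (2 * m.+1%:Z) x) w -> reverses m w.
Proof.
move=> zx m0 h p mp; apply: (@phase_inj m x) => //.
- by rewrite act_letter //; case: h => /legal_letter.
- exact: star_letter.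
- apply: eqmod_trans (phase_star zx m0 mp).
  exact/eqmod_sym/(phase_leads zx h m0 mp).
Qed.

Lemma zigzag_size m x w :
  leads m step4 x (opposite m (2 * m.+1%:Z) x) w -> size w = 'C(m.+1, 2).
Proof.
case=> lw h; apply: double_inj; rewrite (double_size (legal_letter lw)).
rewrite (@eq_big_seq _ _ _ _ _ _ (fun=> m.+1)) => [|i]; last first.
  rewrite mem_iota1 => mi; have := h i mi; have := h _ (star_letter mi).
  rewrite /opposite /step4 starK //; lia.
rewrite big_const_seq count_predT size_iota iter_addn_0 bin2 /=.
by rewrite mulnC -[RHS]odd_double_half; have := oddM m.+1 m; lia.
Qed.

Lemma zigzag_reduced m x w : zigzag m x -> 0 < m ->
  leads m step4 x (opposite m (2 * m.+1%:Z) x) w -> reduced_w0 m w.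
Proof.
move=> zx m0 h; apply: reverses_reduced (zigzag_size h).
  by case: h => /legal_letter.
exact: zigzag_reverses h.
Qed.

(** The phases force the end point of a reduced word of the longest element
up to periods, and its length leaves no period. *)
Lemma reduced_leads m x v w : zigzag m x -> 0 < m ->
  leads m step4 x (opposite m (2 * m.+1%:Z) x) v ->
  legal m step4 x w -> reduced_w0 m w ->
  leads m step4 x (opposite m (2 * m.+1%:Z) x) w.
Proof.
move=> zx m0 hv lw rw; set z := opposite _ _ _.
pose y : height := fun i => (x i + 4 * (count_mem i w)%:Z)%R.
have hw : leads m step4 x y w by split.
have [revw sw] := reduced_reverses (zigzag_reduced zx m0 hv) (zigzag_reverses zx m0 hv) rw.
have [k yz] : exists k : int, forall i, letter m i -> (z i = y i + k * period m)%R.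
  apply: phase_det => //; [exact: zigzag_leads hw | exact: zigzag_leads hv |].
  move=> p mp; apply: eqmod_trans (phase_star zx m0 mp) _; apply: eqmod_sym.
  by rewrite -revw //; exact: phase_leads.
(* a nonzero number of periods would change the length of the word *)
have k0 : k = 0%R.
  have cE i : i \in iota 1 m -> ((count_mem i v)%:Z = (count_mem i w)%:Z + k * m.+1%:Z)%R.
    rewrite mem_iota1 => mi; have := yz i mi; case: (hv) => _ /(_ i mi).
    by rewrite -/z /y /step4 /period; lia.
  have sv := zigzag_size hv.
  have eqs : \sum_(i <- iota 1 m) count_mem i v = \sum_(i <- iota 1 m) count_mem i w.
    by rewrite !sum_count ?sv ?sw //;
      [exact: legal_letter lw | case: hv => /legal_letter].
  have m1 : 1 \in iota 1 m by rewrite mem_iota1 /letter.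
  case: (ltgtP k 0%R) => // k0; exfalso.
    suff : \sum_(i <- iota 1 m) count_mem i v < \sum_(i <- iota 1 m) count_mem i w.
      by rewrite eqs ltnn.
    by apply: (sum_ltn (iota_uniq 1 m) m1) => [i /cE|]; [nia | have := cE 1 m1; nia].
  suff : \sum_(i <- iota 1 m) count_mem i w < \sum_(i <- iota 1 m) count_mem i v.
    by rewrite eqs ltnn.
  by apply: (sum_ltn (iota_uniq 1 m) m1) => [i /cE|]; [nia | have := cE 1 m1; nia].
by apply: leads_ext hw => // i mi; rewrite yz // k0 mul0r addr0.
Qed.

Definition firings (m : nat) (d : height) (c : int) (x : height) : set word :=
  [set w | leads m d x (opposite m c x) w].

Lemma firings_class m d c x w : (forall i, (0 < d i)%R) ->
  firings m d c x w -> firings m d c x = comm_class w.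
Proof.
move=> d0 xw; apply/seteqP; split=> v /= h; first exact: leads_uniq xw h.
exact: leads_comm h xw.
Qed.

Lemma firings_shift m d c x y k :
  (forall i, letter m i -> y i = (x i + k)%R) ->
  firings m d c y = firings m d c x.
Proof.
move=> yx; have xy i : letter m i -> x i = (y i + - k)%R by move=> mi;
  rewrite yx //; ring.
have sub u v l : (forall i, letter m i -> v i = (u i + l)%R) ->
    firings m d c u `<=` firings m d c v.
  move=> vu w /(leads_shift l) /= h; apply: leads_ext h => i mi; first by rewrite vu.
  by rewrite /opposite vu ?star_letter //; ring.
by apply/seteqP; split; apply: sub; [exact: xy | exact: yx].
Qed.

(** All letters occur in the word, hence the order of the first occurrences of
neighbours determines the differences of the heights. *)
Lemma zigzag_uniq m x y w : zigzag m x -> zigzag m y ->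
  firings m step4 (2 * m.+1%:Z) x w -> firings m step4 (2 * m.+1%:Z) y w ->
  exists k : int, forall i, letter m i -> y i = (x i + k)%R.
Proof.
move=> zx zy [lx hx] [ly hy]; exists (y 1%N - x 1%N)%R.
(* neighbouring heights differ by 2, so those of i and its mirror image differ
   by less than 2 (m+1), and i is fired at least once *)
have memw i : letter m i -> i \in w.
  move=> mi; rewrite -has_pred1 has_count.
  have ms := star_letter mi; have := hx i mi; rewrite /opposite /step4.
  case: (leqP i (star m i)) => [h|/ltnW h].
    by have := zigzag_bound zx mi ms h; move: mi; rewrite /letter /star; lia.
  by have := zigzag_bound zx ms mi h; move: mi; rewrite /letter /star; lia.
elim=> // i IH mi; case: (posnP i) => [->|i0]; first by ring.
have li : letter m i by move: mi; rewrite /letter; lia.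
have ii : adjacent i i.+1 by rewrite /adjacent eqxx.
have ii' : adjacent i.+1 i by rewrite adjacent_sym.
have := IH li; have := zx i li mi; have := zy i li mi.
case=> ey; case=> ex; try by lia.
  have := legal_index li mi ii _ ly (memw _ mi).
  have := legal_index mi li ii' _ lx (memw _ li); lia.
have := legal_index li mi ii _ lx (memw _ mi).
have := legal_index mi li ii' _ ly (memw _ li); lia.
Qed.

(** * Dynkin quivers *)

Definition quiver_of (m : nat) (x : height) : rel nat :=
  fun i j => [&& letter m i, letter m j, adjacent i j & (x j < x i)%R].

Lemma zigzag_neq m x i j : zigzag m x -> letter m i -> letter m j ->
  adjacent i j -> (x i = x j + 2 \/ x i = x j - 2)%R.
Proof.
by move=> zx mi mj /orP[]/eqP e; [have := zx i mi | have := zx j mj];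
  rewrite -e => /(_ _); [move=> /(_ mj) | move=> /(_ mi)]; lia.
Qed.

Lemma quiver_of_dynkin m x : zigzag m x -> dynkin_quiver m (quiver_of m x).
Proof.
move=> zx; split=> [i j /and4P[-> -> ->]//|i j mi mj ij].
rewrite /quiver_of mi mj ij adjacent_sym ij /=.
by have := zigzag_neq zx mi mj ij; lia.
Qed.

Lemma quiver_height m q : dynkin_quiver m q ->
  exists x, zigzag m x /\ q =2 quiver_of m x.
Proof.
move=> [q1 q2].
pose x : height := fix x i := if i is k.+1 then (x k + if q k k.+1 then - 2%:Z else 2)%R else 0%R.
have xS k : x k.+1 = (x k + if q k k.+1 then - 2%:Z else 2)%R by [].
exists x; split=> [i mi mi1|i j]; first by rewrite xS; case: ifP; lia.
apply/idP/idP => [qij|/and4P[mi mj ij]].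
  have /and3P[mi mj ij] := q1 _ _ qij; rewrite /quiver_of mi mj ij /=.
  case/orP: ij (ij) => /eqP e ij; subst.
    by rewrite xS qij; lia.
  have := q2 _ _ mi mj ij; rewrite qij xS; case: (q j j.+1) => //; lia.
case/orP: ij (ij) => /eqP e ij; subst; rewrite xS.
  by case: (q i i.+1) => //; lia.
by have := q2 _ _ mi mj ij; case: (q j j.+1); case: (q j.+1 j) => //; lia.
Qed.

Lemma quiver_of_fire m x i : zigzag m x -> fireable m x i ->
  reverse_at i (quiver_of m x) =2 quiver_of m (fire step4 i x).
Proof.
move=> zx fi j k; rewrite /reverse_at /quiver_of.
have mi := fireable_letter fi.
have nb l : letter m l -> adjacent i l -> x l = (x i + 2)%R.
  move=> ml il; case/fireableP: fi => _ /(_ l ml il).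
  by have := zigzag_neq zx mi ml il; lia.
have self : adjacent i i = false by rewrite /adjacent; lia.
rewrite /fire /step4; case: (eqVneq j i) => [->|ji] /=.
  rewrite andbCA; case mk: (letter m k); case ik: (adjacent i k); rewrite ?andbF //=.
    rewrite adjacent_sym ik mi /=; case: eqP => [e|_]; first by rewrite e self in ik.
    by rewrite (nb k) //; lia.
  by rewrite adjacent_sym ik andbF.
case: (eqVneq k i) => [->|ki] //=.
rewrite andbCA; case mj: (letter m j); case ij: (adjacent i j); rewrite ?andbF //=.
  have ji' : adjacent j i by rewrite adjacent_sym.
  by rewrite ji' mi (nb j) //=; lia.
by rewrite [adjacent j i]adjacent_sym ij andbF.
Qed.

Lemma adapted_legal m q x w : zigzag m x -> q =2 quiver_of m x ->
  (adapted m q w <-> legal m step4 x w).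
Proof.
elim: w q x => //= i w IH q x zx qx.
have sinkP : quiver_sink m q i <-> fireable m x i.
  split=> [[mi h]|fi].
    apply/fireableP; split=> // j mj ij; have := h j.
    by rewrite qx /quiver_of mi mj ij /=; have := zigzag_neq zx mi mj ij; lia.
  split; first exact: fireable_letter fi.
  move=> j; rewrite qx; apply/negP => /and4P[mi mj ij].
  by case/fireableP: fi => _ /(_ j mj ij); lia.
have step : fireable m x i ->
    (adapted m (reverse_at i q) w <-> legal m step4 (fire step4 i x) w).
  move=> fi; apply: IH; first exact: zigzag_fire.
  by move=> j k; rewrite -quiver_of_fire // /reverse_at !qx.
split=> [[/sinkP fi /(step fi) lw]|/andP[fi lw]]; first by rewrite fi.
by split; [exact/sinkP | exact/(step fi)].
Qed.

(** The words of the longest element adapted to a quiver are thus the firing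
sequences between two fixed heights; this makes them a single commutation
class. *)
Lemma quiver_classE m q x v : 0 < m -> zigzag m x -> q =2 quiver_of m x ->
  firings m step4 (2 * m.+1%:Z) x v ->
  quiver_class m q = firings m step4 (2 * m.+1%:Z) x.
Proof.
move=> m0 zx qx xv; apply/seteqP; split=> w /=.
  by case=> rw /(adapted_legal _ zx qx) lw; exact: reduced_leads xv lw rw.
move=> h; split; first exact: zigzag_reduced h.
by apply/(adapted_legal _ zx qx); case: h.
Qed.

(** * Twisted heights *)

Definition emb (n i : nat) : nat := if n < i then i.+1 else i.

Definition collapse (n i : nat) : nat := if i <= n then i else i.-1.

Definition twisted_step (n : nat) : height := fun i => if i == n.+1 then 2%Z else 4%Z.

(** The letters other than [n+1] carry a zigzag height of type [A_{2n}]. The letter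
[n+1] moves in steps of 2, twice as often, and lies just below or just above the
lower one of its two neighbours: between any two firings of these neighbours
it is fired once. *)
Definition twisted_height (n : nat) (x : height) : Prop :=
  zigzag n.*2 (x \o emb n) /\
  (x n.+2 = x n + 2 /\ (x n.+1 = x n - 1 \/ x n.+1 = x n + 1) \/
   x n = x n.+2 + 2 /\ (x n.+1 = x n.+2 - 1 \/ x n.+1 = x n.+2 + 1))%R.

Lemma twisted_step_gt0 n i : (0 < twisted_step n i)%R.
Proof. by rewrite /twisted_step; case: eqP. Qed.

Lemma twisted_step_star n i : letter n.*2.+1 i -> twisted_step n (star n.*2.+1 i) = twisted_step n i.
Proof.
move=> mi; rewrite /twisted_step (_ : (star n.*2.+1 i == n.+1) = (i == n.+1)) //.
by move: mi; rewrite /letter /star; lia.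
Qed.

Lemma emb_letter n i : letter n.*2 i -> letter n.*2.+1 (emb n i).
Proof. by rewrite /letter /emb; case: (ltnP n i); lia. Qed.

Lemma emb_neq n i : (emb n i == n.+1) = false.
Proof. by rewrite /emb; case: (ltnP n i); lia. Qed.

Lemma embK n : cancel (emb n) (collapse n).
Proof. by move=> i; rewrite /emb /collapse; case: (ltnP n i) => h;
  case: (leqP _ n); lia. Qed.

Lemma collapseK n i : i != n.+1 -> emb n (collapse n i) = i.
Proof. by rewrite /emb /collapse; case: (leqP i n) => h; case: (ltnP n _); lia. Qed.

Lemma collapse_letter n i : letter n.*2.+1 i -> i != n.+1 ->
  letter n.*2 (collapse n i).
Proof. by rewrite /letter /collapse; case: (leqP i n); lia. Qed.

Lemma emb_star n i : letter n.*2 i ->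
  emb n (star n.*2 i) = star n.*2.+1 (emb n i).
Proof. by rewrite /letter /emb /star; case: (ltnP n i);
  case: (ltnP n (n.*2.+1 - i)); lia. Qed.

Lemma emb_adjacent n i j : adjacent (emb n i) (emb n j) ->
  adjacent i j.
Proof. by rewrite /adjacent /emb; case: (ltnP n i); case: (ltnP n j); lia. Qed.

Lemma collapse_eq n i j : i != n.+1 -> (emb n j == i) = (j == collapse n i).
Proof.
move=> i1; apply/eqP/eqP => [<-|->]; by rewrite ?embK ?collapseK.
Qed.

Lemma fire_centre n x : fire (twisted_step n) n.+1 x \o emb n = x \o emb n.
Proof. by apply: funext => j; rewrite /fire /= emb_neq. Qed.

Lemma fire_outer n x i : i != n.+1 ->
  fire (twisted_step n) i x \o emb n = fire step4 (collapse n i) (x \o emb n).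
Proof.
move=> i1; apply: funext => j; rewrite /fire /= collapse_eq //.
by case: eqP => // ->; rewrite /twisted_step collapseK // (negPf i1).
Qed.

(** In type [A_{2n}] the letters [n] and [n+2] become neighbours. The condition
between them is not lost in type [A_{2n+1}]: only the lower one of them can lie
below [n+1]. *)
Lemma fireable_outer n x i : 0 < n -> twisted_height n x -> i != n.+1 ->
  fireable n.*2.+1 x i = [&& fireable n.*2 (x \o emb n) (collapse n i),
    (i == n) ==> (x n < x n.+1)%R & (i == n.+2) ==> (x n.+2 < x n.+1)%R].
Proof.
move=> n0 [_ cx] i1.
have [l1 l2 l0] : [/\ letter n.*2.+1 n.+1, letter n.*2.+1 n.+2 & letter n.*2.+1 n].
  by split; rewrite /letter; lia.
have a1 : adjacent n n.+1 by rewrite /adjacent eqxx.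
have a2 : adjacent n.+2 n.+1 by rewrite /adjacent eqxx orbT.
apply/fireableP/and3P => [[mi h]|[/fireableP[mi h] h1 h2]].
  have h1 : (i == n) ==> (x n < x n.+1)%R by apply/implyP => /eqP e; subst; exact: h.
  have h2 : (i == n.+2) ==> (x n.+2 < x n.+1)%R by apply/implyP => /eqP e;
    subst; exact: h.
  split=> //; apply/fireableP; split; first exact: collapse_letter.
  move=> j mj cj /=; rewrite collapseK //.
  have [e|ni] := eqVneq i n.
    have [ej|nj] := eqVneq (emb n j) n.+2; first by move: h1; rewrite e ej eqxx; lia.
    apply: h; first exact: emb_letter.
    by move: cj nj (emb_neq n j); rewrite e /collapse leqnn /adjacent /emb;
      case: (ltnP n j); lia.
  have [e|ni2] := eqVneq i n.+2.
    have [ej|nj] := eqVneq (emb n j) n; first by move: h2; rewrite e ej eqxx; lia.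
    apply: h; first exact: emb_letter.
    move: cj nj (emb_neq n j); rewrite e /collapse /adjacent /emb;
      case: (leqP n.+2 n); case: (ltnP n j); lia.
  apply: h; first exact: emb_letter.
  move: cj i1 ni ni2 (emb_neq n j); rewrite /collapse /adjacent /emb;
    case: (leqP i n); case: (ltnP n j); lia.
have mi' : letter n.*2.+1 i by rewrite -(collapseK i1) emb_letter.
split=> // j mj ij; case: (eqVneq j n.+1) => [ej|nj].
  move: ij; rewrite ej /adjacent eqSS => /orP[]/eqP e.
    by move: h1; rewrite e eqxx.
  by move: h2; rewrite e eqxx.
have := h (collapse n j); rewrite /= !collapseK //; apply;
  first exact: collapse_letter.
by apply: (@emb_adjacent n); rewrite !collapseK.
Qed.

Lemma fireable_centre n x : 0 < n -> fireable n.*2.+1 x n.+1 =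
  (x n.+1 < x n)%R && (x n.+1 < x n.+2)%R.
Proof.
move=> n0; apply/idP/idP => [f|/andP[h1 h2]].
  have := fireableP1 f; have := fireableS f; rewrite /letter => -> //=; last by lia.
  by move=> ->; lia.
apply/fireableP; split; first by rewrite /letter; lia.
by move=> j _; rewrite /adjacent eqSS => /orP[]/eqP e; rewrite ?e // -e.
Qed.

Lemma twisted_fire n x i : 0 < n -> twisted_height n x ->
  fireable n.*2.+1 x i -> twisted_height n (fire (twisted_step n) i x).
Proof.
move=> n0 tx fi; case: (tx) => zx cx; case: (eqVneq i n.+1) fi => [->|i1] fi.
  split; first by rewrite fire_centre.
  move: fi; rewrite fireable_centre // /fire /twisted_step eqxx.
  by rewrite !ifF; [case/andP; lia | lia..].
move: fi; rewrite fireable_outer // => /and3P[fi h1 h2].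
split; first by rewrite fire_outer //; exact: zigzag_fire.
rewrite /fire /twisted_step; have [e|ni] := eqVneq i n.
  by move: h1; rewrite e eqxx !ifF; [lia | lia..].
have [e|ni2] := eqVneq i n.+2.
  by move: h2; rewrite e eqxx !ifF; [lia | lia..].
by rewrite !ifF; [lia | lia..].
Qed.

Lemma twisted_ext n x y : 0 < n -> (forall i, letter n.*2.+1 i -> y i = x i) ->
  twisted_height n x -> twisted_height n y.
Proof.
move=> n0 yx [zx cx]; split.
  by apply: zigzag_ext zx => i mi; exact: yx (emb_letter mi).
by rewrite !yx // /letter; lia.
Qed.

Lemma twisted_leads n x y w : 0 < n -> twisted_height n x ->
  leads n.*2.+1 (twisted_step n) x y w -> twisted_height n y.
Proof.
move=> n0; elim: w x => [|i w IH] x tx.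
  by case=> _ h; apply: twisted_ext tx => // i mi; rewrite h //= mulr0 addr0.
by case/leads_cons=> fi; apply: IH; exact: twisted_fire.
Qed.

Lemma P_leads n x y w : 0 < n -> twisted_height n x ->
  leads n.*2.+1 (twisted_step n) x y w ->
  leads n.*2 step4 (x \o emb n) (y \o emb n) (P_word n w).
Proof.
move=> n0; elim: w x => [|i w IH] x tx.
  case=> _ h; apply: leads_nil => i mi /=.
  by rewrite h ?mulr0 ?addr0 //; exact: emb_letter.
case/leads_cons=> fi hw; rewrite /P_word /=.
have := IH _ (twisted_fire n0 tx fi) hw.
case: (eqVneq i n.+1) fi => [->|i1] fi /=; first by rewrite fire_centre.
rewrite fire_outer // => h; apply/leads_cons; split=> //.
by move: fi; rewrite fireable_outer // => /and3P[].
Qed.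

Lemma opposite_emb n c x i : letter n.*2 i ->
  (opposite n.*2.+1 c x \o emb n) i = opposite n.*2 c (x \o emb n) i.
Proof. by move=> mi; rewrite /opposite /= emb_star. Qed.

Lemma zigzag_opposite m c x : zigzag m x -> zigzag m (opposite m c x).
Proof.
move=> zx i mi mi1; have := zx (star m i.+1) (star_letter mi1).
rewrite (_ : (star m i.+1).+1 = star m i); last by move: mi1;
  rewrite /letter /star; lia.
by move=> /(_ (star_letter mi)); rewrite /opposite; lia.
Qed.

Lemma star_centre n :
  [/\ star n.*2.+1 n.+1 = n.+1, star n.*2.+1 n.+2 = n & star n.*2.+1 n = n.+2].
Proof. by split; rewrite /star; lia. Qed.

Lemma twisted_opposite n c x : 0 < n -> twisted_height n x ->
  twisted_height n (opposite n.*2.+1 c x).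
Proof.
move=> n0 [zx cx]; split.
  apply: zigzag_ext (zigzag_opposite c zx) => i; exact: opposite_emb.
by rewrite /opposite; have [-> -> ->] := star_centre n; lia.
Qed.

Lemma twisted_shift n x k : twisted_height n x ->
  twisted_height n (fun i => (x i + k)%R).
Proof.
move=> [zx cx]; split; last by lia.
by move=> i mi mi1; have := zx i mi mi1; rewrite /=; lia.
Qed.

(** Heights are determined modulo the steps by the height of the first letter,
since neighbours differ by 2 modulo 4 and the centre is odd relative to them. *)
Lemma twisted_congr n x y : 0 < n -> twisted_height n x -> twisted_height n y ->
  (exists k : int, y 1%N = x 1%N + k * 4)%R ->
  forall i, letter n.*2.+1 i -> exists k : int, (y i = x i + k * twisted_step n i)%R.
Proof.
move=> n0 [zx cx] [zy cy] [k e].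
have l1 : letter n.*2 1 by rewrite /letter; lia.
have out i : letter n.*2.+1 i -> i != n.+1 -> exists k : int, (y i = x i + k * 4)%R.
  move=> mi i1; have ci := collapse_letter mi i1.
  have [k1] := zigzag_mod4 zx l1 ci; have [k2] := zigzag_mod4 zy l1 ci.
  by rewrite /= collapseK // /emb ltnNge n0 /= => -> ->; exists (k + k2 - k1)%R; lia.
move=> i mi; rewrite /twisted_step; case: (eqVneq i n.+1) => [->|]; last exact: out.
have [||k1 e1] := out n; [by rewrite /letter; lia | by lia |].
have [||k2 e2] := out n.+2; [by rewrite /letter; lia | by lia |].
exists ((y n.+1 - x n.+1) %/ 2)%Z; lia.
Qed.

Lemma lowest (s : seq nat) (x : height) : s != [::] ->
  exists2 i, i \in s & forall j, j \in s -> (x i <= x j)%R.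
Proof.
elim: s => // i s IH _; case: (eqVneq s [::]) => [->|/IH [j js hj]].
  by exists i => [|j]; rewrite inE ?eqxx // => /eqP ->.
case: (leP (x i) (x j)) => ij.
  exists i; rewrite ?inE ?eqxx // => k; rewrite inE => /orP[/eqP -> //|/hj]; lia.
exists j; rewrite ?inE ?js ?orbT // => k; rewrite inE => /orP[/eqP -> |/hj //]; lia.
Qed.

(** The lowest letter that has not reached its target can be fired: a lower
neighbour would have reached its own target, which would then lie too far
below the target of the letter. *)
Lemma twisted_fireable n x y i : 0 < n -> twisted_height n x ->
  twisted_height n y -> letter n.*2.+1 i -> (x i + twisted_step n i <= y i)%R ->
  (forall j, letter n.*2.+1 j -> (x j < y j)%R -> (x i <= x j)%R) ->
  fireable n.*2.+1 x i.
Proof.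
move=> n0 [zx cx] [zy cy] mi; rewrite /twisted_step => lti hmin.
have l0 : letter n.*2.+1 n by rewrite /letter; lia.
have l1 : letter n.*2.+1 n.+1 by rewrite /letter; lia.
have l2 : letter n.*2.+1 n.+2 by rewrite /letter; lia.
have h0 := hmin n l0; have h1 := hmin n.+1 l1; have h2 := hmin n.+2 l2.
case: (eqVneq i n.+1) lti => [e|i1] lti.
  by rewrite e fireable_centre //; move: h0 h2 lti; rewrite e; lia.
rewrite fireable_outer //; apply/and3P; split; last first.
- by apply/implyP => /eqP e; move: h0 h1 h2 lti; rewrite e; lia.
- by apply/implyP => /eqP e; move: h0 h1 h2 lti; rewrite e; lia.
apply/fireableP; split; first exact: collapse_letter.
move=> j mj ij; have mc := collapse_letter mi i1.
have := zigzag_neq zx mc mj ij; have := zigzag_neq zy mc mj ij.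
rewrite /= collapseK //; have := hmin _ (emb_letter mj); lia.
Qed.

(** All the words needed below exist by this lemma: the words of the twisted
classes, their first and last letters, the Coxeter words, and the words along
which the cluster is connected. *)
Lemma twisted_path n x y : 0 < n -> twisted_height n x -> twisted_height n y ->
  (forall i, letter n.*2.+1 i -> (x i <= y i)%R) ->
  (forall i, letter n.*2.+1 i ->
     exists k : int, (y i = x i + k * twisted_step n i)%R) ->
  exists w, leads n.*2.+1 (twisted_step n) x y w.
Proof.
move=> n0 + ty; pose mu z := \sum_(i <- iota 1 n.*2.+1) `|(y i - z i)%R|%N.
have [k] := ubnP (mu x); elim: k x => // k IH x; rewrite ltnS => muk tx le dv.
pose s := [seq i <- iota 1 n.*2.+1 | (x i < y i)%R].
case: (eqVneq s [::]) => [s0|/(lowest x)[i]].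
  exists [::]; apply: leads_nil => i mi; apply/eqP; rewrite eq_le le // andbT leNgt.
  by apply/negP => h; have : i \in s; [rewrite mem_filter h mem_iota1 | rewrite s0].
rewrite mem_filter mem_iota1 => /andP[lti mi] hmin.
have [l e] := dv i mi; have := twisted_step_gt0 n i => d0.
have l0 : (0 < l)%R by nia.
have fi : fireable n.*2.+1 x i.
  apply: (@twisted_fireable n x y) => // [|j mj ltj]; first by nia.
  by apply: hmin; rewrite mem_filter ltj mem_iota1.
have [||||w hw] := IH (fire (twisted_step n) i x).
- apply: leq_trans muk; apply: (sum_ltn (iota_uniq 1 _) (c := i)).
  + by rewrite mem_iota1.
  + by move=> j _; rewrite /fire; case: eqP => // ->; nia.
  + by rewrite /fire eqxx; nia.
- exact: twisted_fire.
- move=> j mj; rewrite /fire; case: eqP => [->|_]; [nia | exact: le].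
- move=> j mj; rewrite /fire; case: eqP => [->|_]; last exact: dv.
  by exists (l - 1)%R; rewrite e; ring.
by exists (i :: w); apply/leads_cons.
Qed.

(** * The twisted cluster *)

(** A class of the cluster consists of the firing sequences that lead from a
twisted height to its mirror image raised by twice the Coxeter number of
[A_{2n}]; a reflection functor slides this window by one letter. *)
Definition twisted_class (n : nat) : height -> set word :=
  firings n.*2.+1 (twisted_step n) (2 * n.*2.+1%:Z).

Lemma twisted_classE n x w : twisted_class n x w ->
  twisted_class n x = comm_class w.
Proof. exact/firings_class/twisted_step_gt0. Qed.

Lemma opposite_gap n x i : 0 < n -> twisted_height n x -> letter n.*2.+1 i ->
  (x i + twisted_step n i <= opposite n.*2.+1 (2 * n.*2.+1%:Z) x i)%R.
Proof.
move=> n0 [zx cx] mi; rewrite /twisted_step /opposite;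
  case: (eqVneq i n.+1) => [->|i1].
  by have [-> _ _] := star_centre n; lia.
have mc := collapse_letter mi i1; have ms := star_letter mc.
rewrite -{2}(collapseK i1) -emb_star // -{1}(collapseK i1).
case: (leqP (collapse n i) (star n.*2 (collapse n i))) => [h|/ltnW h].
  by have := zigzag_bound zx mc ms h; move: mc; rewrite /= /letter /star; lia.
by have := zigzag_bound zx ms mc h; move: mc; rewrite /= /letter /star; lia.
Qed.

Lemma opposite_congr n x i : 0 < n -> twisted_height n x -> letter n.*2.+1 i ->
  exists k : int,
    (opposite n.*2.+1 (2 * n.*2.+1%:Z) x i = x i + k * twisted_step n i)%R.
Proof.
move=> n0 tx; apply: twisted_congr => //; first exact: twisted_opposite.
have m1 : letter n.*2 1 by rewrite /letter; lia.
have [k] := zigzag_mod4 tx.1 m1 (star_letter m1).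
rewrite /= emb_star // /opposite (_ : emb n 1 = 1) => [->|]; last first.
  by rewrite /emb ltnNge n0.
by exists (k + 2 * n%:Z)%R; rewrite /star; lia.
Qed.

Lemma twisted_class_cons n x i : 0 < n -> twisted_height n x ->
  fireable n.*2.+1 x i -> exists u, twisted_class n x (i :: u).
Proof.
move=> n0 tx fi; have [u hu] : exists u, leads n.*2.+1 (twisted_step n)
    (fire (twisted_step n) i x) (opposite n.*2.+1 (2 * n.*2.+1%:Z) x) u.
  apply: twisted_path => //.
  - exact: twisted_fire.
  - exact: twisted_opposite.
  - move=> j mj; have := opposite_gap n0 tx mj; have := twisted_step_gt0 n j.
    by rewrite /fire; case: eqP => // _; lia.
  - move=> j mj; have [k ->] := opposite_congr n0 tx mj.
    rewrite /fire; case: eqP => _; last by exists k.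
    by exists (k - 1)%R; ring.
by exists u; apply/leads_cons.
Qed.

Lemma twisted_class_inhabited n x : 0 < n -> twisted_height n x ->
  exists w, twisted_class n x w.
Proof.
move=> n0 tx; apply: twisted_path => //; first exact: twisted_opposite.
  by move=> j mj; have := opposite_gap n0 tx mj; have := twisted_step_gt0 n j; lia.
by move=> j mj; exact: opposite_congr.
Qed.

Lemma twisted_sink n x i : 0 < n -> twisted_height n x ->
  is_sink (twisted_class n x) i <-> fireable n.*2.+1 x i.
Proof.
move=> n0 tx; split=> [[u /leads_cons[]//]|fi].
by have [u hu] := twisted_class_cons n0 tx fi; exists u.
Qed.

Lemma fire_star n x i j : letter n.*2.+1 i -> letter n.*2.+1 j ->
  fire (twisted_step n) i x (star n.*2.+1 j) =
  fire (twisted_step n) (star n.*2.+1 i) (x \o star n.*2.+1) j.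
Proof.
move=> mi mj; rewrite /fire /= twisted_step_star //.
rewrite (_ : (star n.*2.+1 j == i) = (j == star n.*2.+1 i)) //.
by apply/eqP/eqP => [<-|->]; rewrite starK.
Qed.

Lemma fireable_shift m x c i :
  fireable m (fun j => (x j + c)%R) i = fireable m x i.
Proof. by have := legal_shift m step4 x c [:: i]; rewrite /= !andbT. Qed.

Lemma leads_rcons m d x z w i : leads m d x z (rcons w i) ->
  exists y, [/\ leads m d x y w, fireable m y i &
    forall j, letter m j -> z j = fire d i y j].
Proof.
move=> [lw h]; pose y : height := fun j => (x j + d j * (count_mem j w)%:Z)%R.
have yE : foldl (fun z j => fire d j z) x w = y.
  by apply: funext => j; rewrite foldl_fire.
move: lw; rewrite -cats1 legal_cat /= andbT yE => /andP[lw fi].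
exists y; split=> // j mj; rewrite h // -cats1 count_cat /= addn0 /fire /y eq_sym.
by case: eqP => _; rewrite ?addn0 // PoszD mulrDr mulr1 addrA.
Qed.

(** If [i u] leads from [x] to its raised mirror image, then [u] starts one firing
later, and the mirror letter of [i] completes it to the next mirror image. *)
Lemma refl_right_class n x i : 0 < n -> twisted_height n x ->
  letter n.*2.+1 i ->
  refl_right n.*2.+1 (twisted_class n x) i =
  if fireable n.*2.+1 x i then twisted_class n (fire (twisted_step n) i x)
  else twisted_class n x.
Proof.
move=> n0 tx mi; rewrite /refl_right; case: asboolP => [/(twisted_sink _ n0 tx)|ns].
  move=> fi; rewrite fi; have tf := twisted_fire n0 tx fi.
  have slide u : twisted_class n x (i :: u) ->
      twisted_class n (fire (twisted_step n) i x) (rcons u (star n.*2.+1 i)).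
    case/leads_cons=> _ hu; rewrite -cats1; apply: leads_cat hu _.
    apply/leads_cons; split.
      by rewrite fireable_shift fireable_star.
    apply: leads_nil => j mj; rewrite /opposite fire_star // /fire /=.
    by case: eqP => // _; ring.
  apply/seteqP; split=> w /=.
    by case=> u /slide /twisted_classE <-.
  move=> hw; have [u hu] := twisted_class_cons n0 tx fi.
  by exists u => //; rewrite /= -(twisted_classE (slide u hu)).
by case: ifP => // fi; case: ns; apply/(twisted_sink i n0 tx).
Qed.

(** The height before the last letter is the raised mirror image of some height,
from which the mirror letter followed by the rest of the word starts. *)
Lemma refl_left_class n x i : 0 < n -> twisted_height n x ->
  letter n.*2.+1 i -> exists2 y, twisted_height n y &
  refl_left n.*2.+1 i (twisted_class n x) = twisted_class n y.
Proof.
move=> n0 tx mi; rewrite /refl_left; case: asboolP => [[u0 h0]|_]; last by exists x.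
set c := (2 * n.*2.+1%:Z)%R.
have [y [hy fy yz]] := leads_rcons h0.
have ty : twisted_height n y by exact: twisted_leads hy.
pose x' := opposite n.*2.+1 (- c) y.
have tx' : twisted_height n x' by exact: twisted_opposite.
have x'y j : letter n.*2.+1 j -> opposite n.*2.+1 c x' j = y j.
  by move=> mj; rewrite /x' /opposite starK //; ring.
have fx' : fireable n.*2.+1 x' (star n.*2.+1 i).
  by rewrite fireable_shift fireable_star.
have x'x j : letter n.*2.+1 j -> fire (twisted_step n) (star n.*2.+1 i) x' j = x j.
  move=> mj; have := yz _ (star_letter mj).
  rewrite fire_star // {1}/opposite starK // -/c /fire /x' /opposite /=.
  by case: eqP => _ e; lia.
have slide u : twisted_class n x (rcons u i) ->
    twisted_class n x' (star n.*2.+1 i :: u).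
  move=> /leads_rcons[z [hz fz zz]]; apply/leads_cons; split=> //.
  apply: leads_ext hz => j mj; first by rewrite x'x.
  rewrite x'y //; have := yz j mj; rewrite zz // /fire; case: eqP => // _; lia.
exists x' => //; apply/seteqP; split=> w /=.
  by case=> u /slide /twisted_classE <-.
by move=> hw; exists u0 => //; rewrite /= -(twisted_classE (slide u0 h0)).
Qed.

Lemma refl_equiv_trans m c d e : refl_equiv m c d -> refl_equiv m d e ->
  refl_equiv m c e.
Proof.
move=> cd; elim=> // [f i mi df cf|f i mi df cf].
  exact: refl_equiv_right.
exact: refl_equiv_left.
Qed.

Lemma refl_equiv_leads n x y w : 0 < n -> twisted_height n x ->
  leads n.*2.+1 (twisted_step n) x y w ->
  refl_equiv n.*2.+1 (twisted_class n x) (twisted_class n y).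
Proof.
move=> n0; elim: w x => [|i w IH] x tx.
  case=> _ h; rewrite (_ : twisted_class n y = twisted_class n x).
    exact: refl_equiv_refl.
  apply: (@firings_shift _ _ _ _ _ 0%R) => i mi.
  by rewrite h //= mulr0 !addr0.
case/leads_cons=> fi /(IH _ (twisted_fire n0 tx fi)); apply: refl_equiv_trans.
have := refl_right_class n0 tx (fireable_letter fi); rewrite fi => <-.
apply: refl_equiv_right; first exact: fireable_letter fi.
exact: refl_equiv_refl.
Qed.

(** All twisted heights occur: up to a translation, which does not change the
class, any of them can be reached by firing. *)
Lemma cluster_point_twisted n x w : 0 < n -> twisted_height n x ->
  twisted_class n x w ->
  cluster_point n.*2.+1 w =
  [set c | exists2 y, twisted_height n y & c = twisted_class n y].
Proof.
move=> n0 tx hw; rewrite /cluster_point -(twisted_classE hw).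
apply/seteqP; split=> c /=.
  elim=> [|d i mi _ [y ty ->]|d i mi _ [y ty ->]]; first by exists x.
    rewrite refl_right_class //; case: ifP => fi; last by exists y.
    by exists (fire (twisted_step n) i y) => //; exact: twisted_fire.
  by have [z tz ->] := refl_left_class n0 ty mi; exists z.
case=> y ty ->.
pose b := \sum_(i <- iota 1 n.*2.+1) `|(x i - y i)%R|%N.
(* a translation with the residue required at the letter 1, large enough for
   the translated height to lie above x *)
pose k := (x 1%N - y 1%N + 4 * (b%:Z + `|x 1%N - y 1%N|))%R.
have le i : letter n.*2.+1 i -> (x i - y i <= b%:Z)%R.
  move=> mi; suff : `|(x i - y i)%R|%N <= b by lia.
  by rewrite /b (bigD1_seq i) ?iota_uniq ?mem_iota1 //= leq_addr.
have [v hv] : exists v, leads n.*2.+1 (twisted_step n) x (fun i => (y i + k)%R) v.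
  apply: twisted_path => //; first exact: twisted_shift.
    by move=> i /le; rewrite /k; lia.
  apply: twisted_congr => //; first exact: twisted_shift.
  by exists (b%:Z + `|x 1%N - y 1%N|)%R; rewrite /k; ring.
have <- : twisted_class n (fun i => (y i + k)%R) = twisted_class n y.
  exact: (@firings_shift _ _ _ _ _ k).
exact: refl_equiv_leads hv.
Qed.

(** * The projection to type [A_{2n}] *)

Definition zigzag_class (n : nat) : height -> set word :=
  firings n.*2 step4 (2 * n.*2.+1%:Z).

Definition pending (n : nat) (x : height) : bool :=
  (x n.+1 < x n)%R && (x n.+1 < x n.+2)%R.

Lemma zigzag_classE n x w : zigzag_class n x w -> zigzag_class n x = comm_class w.
Proof. exact: firings_class. Qed.

Lemma P_twisted n x w : 0 < n -> twisted_height n x -> twisted_class n x w ->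
  zigzag_class n (x \o emb n) (P_word n w).
Proof.
move=> n0 tx /(P_leads n0 tx); apply: leads_ext => // i mi.
exact: opposite_emb.
Qed.

Lemma P_class_twisted n x : 0 < n -> twisted_height n x ->
  P_class n (twisted_class n x) = zigzag_class n (x \o emb n).
Proof.
move=> n0 tx; apply/seteqP; split=> w /=.
  by case=> u hu; rewrite -(zigzag_classE (P_twisted n0 tx hu)).
move=> hw; have [u hu] := twisted_class_inhabited n0 tx.
by exists u => //; rewrite -(zigzag_classE (P_twisted n0 tx hu)).
Qed.

(** For [b] true the letter [n+1] is due before the letters [n] and [n+2], as it
lies below both of them; otherwise it has just been fired. *)
Definition lift_height (n : nat) (b : bool) (x : height) : height := fun j =>
  if j == n.+1 then
    ((if x n < x n.+1 then x n else x n.+1) + if b then - 1%:Z else 1)%R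
  else x (collapse n j).

Lemma lift_emb n b x : lift_height n b x \o emb n = x.
Proof. by apply: funext => i; rewrite /lift_height /= emb_neq embK. Qed.

Lemma lift_centre n b x :
  [/\ lift_height n b x n = x n, lift_height n b x n.+2 = x n.+1 &
      lift_height n b x n.+1 =
      ((if x n < x n.+1 then x n else x n.+1) + if b then - 1%:Z else 1)%R].
Proof.
have [e0 e2 e3] : [/\ n == n.+1 = false, n.+2 == n.+1 = false & (n.+2 <= n) = false].
  by split; lia.
by rewrite /lift_height eqxx /collapse leqnn e0 e2 e3.
Qed.

Lemma zigzag_centre n x : 0 < n -> zigzag n.*2 x ->
  (x n.+1 = x n + 2 \/ x n.+1 = x n - 2)%R.
Proof. by move=> n0; apply; rewrite /letter; lia. Qed.

Lemma lift_twisted n b x : 0 < n -> zigzag n.*2 x ->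
  twisted_height n (lift_height n b x).
Proof.
move=> n0 zx; split; first by rewrite lift_emb.
have [-> -> ->] := lift_centre n b x; have := zigzag_centre n0 zx.
by case: ifP => h; case: b; lia.
Qed.

Lemma lift_pending n b x : 0 < n -> zigzag n.*2 x ->
  pending n (lift_height n b x) = b.
Proof.
move=> n0 zx; rewrite /pending; have [-> -> ->] := lift_centre n b x;
  have := zigzag_centre n0 zx.
by case: ifP => h; case: b; lia.
Qed.

Lemma zigzag_class_inhabited n x : 0 < n -> zigzag n.*2 x ->
  exists w, zigzag_class n x w.
Proof.
move=> n0 zx; have tx := lift_twisted true n0 zx.
have [w hw] := twisted_class_inhabited n0 tx.
by exists (P_word n w); have := P_twisted n0 tx hw; rewrite lift_emb.
Qed.

Lemma quiver_zigzag n q x : 0 < n -> zigzag n.*2 x -> q =2 quiver_of n.*2 x ->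
  quiver_class n.*2 q = zigzag_class n x.
Proof.
move=> n0 zx qx; have [w hw] := zigzag_class_inhabited n0 zx.
by apply: quiver_classE hw => //; rewrite double_gt0.
Qed.

Lemma sink_centre n x : 0 < n -> twisted_height n x ->
  is_sink (twisted_class n x) n.+1 <-> pending n x.
Proof. by move=> n0 tx; rewrite /pending -fireable_centre //;
  exact: twisted_sink. Qed.

(** The height before a last letter [n+1] is twisted, and there the letter
[n+1] is pending; in the end, thus also in the beginning, it is not. *)
Lemma source_centre n x : 0 < n -> twisted_height n x ->
  is_source (twisted_class n x) n.+1 <-> ~~ pending n x.
Proof.
move=> n0 tx; have ml : letter n.*2.+1 n.+1 by rewrite /letter; lia.
have ml0 : letter n.*2.+1 n by rewrite /letter; lia.
have ml2 : letter n.*2.+1 n.+2 by rewrite /letter; lia.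
have [s1 s2 s0] := star_centre n; have [_ cx] := tx.
split=> [[u hu]|np].
  have [y [hy fy yz]] := leads_rcons hu; have [_ cy] := twisted_leads n0 tx hy.
  have := yz _ ml; have := yz _ ml0; have := yz _ ml2.
  rewrite /opposite s1 s2 s0 /fire /twisted_step eqxx.
  move: fy; rewrite fireable_centre // /pending !ifF; [lia | lia..].
(* y is the target before its last letter n+1 is fired *)
pose z := opposite n.*2.+1 (2 * n.*2.+1%:Z) x.
pose y : height := fun j => if j == n.+1 then (z j - 2)%R else z j.
have tz : twisted_height n z by exact: twisted_opposite.
have [cy1 [cy2 cy0]] : y n.+1 = (z n.+1 - 2)%R /\ y n.+2 = z n.+2 /\ y n = z n.
  by rewrite /y eqxx !ifF; [| lia..].
have npz : ~~ pending n z by move: np; rewrite /z /pending /opposite s1 s2 s0; lia.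
have ty : twisted_height n y.
  case: tz => zz cz; split; last by rewrite cy1 cy2 cy0; move: npz;
    rewrite /pending; lia.
  by rewrite (_ : y \o emb n = z \o emb n) //; apply: funext => i;
    rewrite /y /= emb_neq.
have [u hu] : exists u, leads n.*2.+1 (twisted_step n) x y u.
  apply: twisted_path => // i mi.
    have := opposite_gap n0 tx mi; rewrite -/z /y /twisted_step; case: eqP => _; lia.
  have [k] := opposite_congr n0 tx mi; rewrite -/z /y => ->.
  case: eqP => [e|_]; last by exists k.
  by exists (k - 1)%R; rewrite /twisted_step e eqxx; ring.
exists u; rewrite -cats1; apply: leads_cat hu _; apply/leads_cons; split.
  by rewrite fireable_centre // cy0 cy1 cy2; case: tz => _; move: npz;
    rewrite /pending; lia.
apply: leads_nil => i mi; rewrite -/z /fire /y /twisted_step; case: eqP => // _; ring.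
Qed.

Lemma twisted_class_lift n x y k : 0 < n -> twisted_height n x ->
  zigzag n.*2 y -> (forall i, letter n.*2 i -> x (emb n i) = (y i + k)%R) ->
  twisted_class n x = twisted_class n (lift_height n (pending n x) y).
Proof.
move=> n0 [zx cx] zy xy; apply: (@firings_shift _ _ _ _ _ k) => i mi.
case: (eqVneq i n.+1) => [->|i1]; last first.
  rewrite -{1}(collapseK i1) xy; last exact: collapse_letter.
  by rewrite /lift_height (negPf i1).
have e0 : x n = (y n + k)%R.
  by rewrite -xy /emb ?ltnn // /letter; lia.
have e2 : x n.+2 = (y n.+1 + k)%R.
  by rewrite -xy /emb ?ltnS ?leqnn // /letter; lia.
rewrite /lift_height eqxx /pending; case: ifP => h; case: ifP => h'; lia.
Qed.

Lemma twisted_class_inj n x y : 0 < n -> twisted_height n x ->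
  twisted_height n y -> twisted_class n x = twisted_class n y ->
  exists k : int, forall i, letter n.*2.+1 i -> y i = (x i + k)%R.
Proof.
move=> n0 tx ty xy; have [w hw] := twisted_class_inhabited n0 tx.
have hw' : twisted_class n y w by rewrite -xy.
have [k hk] := zigzag_uniq tx.1 ty.1 (P_twisted n0 tx hw) (P_twisted n0 ty hw').
exists k => i mi; case: (eqVneq i n.+1) => [->|i1]; last first.
  by have := hk _ (collapse_letter mi i1); rewrite /= collapseK.
have e0 : y n = (x n + k)%R.
  by have := hk n; rewrite /= /emb ltnn; apply; rewrite /letter; lia.
have e2 : y n.+2 = (x n.+2 + k)%R.
  by have := hk n.+1; rewrite /= /emb leqnn; apply; rewrite /letter; lia.
have : pending n x = pending n y.
  by apply/idP/idP => /sink_centre h; apply/sink_centre => //;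
    [rewrite -xy | rewrite xy];
     apply: h.
by rewrite /pending; case: tx => _; case: ty => _; lia.
Qed.

(** The class of the quiver determines the outer heights up to translation, which
leaves the two possible heights of the letter [n+1]. *)
Lemma P_fiberE n q y : 0 < n -> zigzag n.*2 y -> q =2 quiver_of n.*2 y ->
  [set c | (exists2 x, twisted_height n x & c = twisted_class n x) /\
           P_class n c = quiver_class n.*2 q] =
  [set twisted_class n (lift_height n true y);
       twisted_class n (lift_height n false y)].
Proof.
move=> n0 zy qy; have qE := quiver_zigzag n0 zy qy.
apply/seteqP; split=> c /=; last first.
  have tb b := lift_twisted b n0 zy.
  have mem b : (exists2 x, twisted_height n x &
      twisted_class n (lift_height n b y) = twisted_class n x) /\
      P_class n (twisted_class n (lift_height n b y)) = quiver_class n.*2 q.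
    by split; [exists (lift_height n b y) | rewrite P_class_twisted // lift_emb qE].
  by case=> ->; exact: mem.
case=> -[x tx ->]; rewrite P_class_twisted // qE => xy.
have [w hw] := zigzag_class_inhabited n0 zy.
have hw' : zigzag_class n (x \o emb n) w by rewrite xy.
have [k hk] := zigzag_uniq zy tx.1 hw hw'.
rewrite (@twisted_class_lift n x y k) //.
by case: (pending n x); [left | right].
Qed.

(** * Insertion of the letters [n+1] *)

(** Legality as seen by the three central letters alone. *)
Fixpoint centre_legal (n : nat) (x : height) (s : word) : bool :=
  if s is i :: s' then
    [&& (i == n) ==> (x n < x n.+1)%R, (i == n.+2) ==> (x n.+2 < x n.+1)%R,
        (i == n.+1) ==> pending n x & centre_legal n (fire (twisted_step n) i x) s']
  else true.

Lemma centre_legal_ext n x y s : x n = y n -> x n.+1 = y n.+1 ->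
  x n.+2 = y n.+2 -> centre_legal n x s = centre_legal n y s.
Proof.
elim: s x y => //= i s IH x y e0 e1 e2; rewrite /pending e0 e1 e2.
by rewrite (IH _ (fire (twisted_step n) i y)) // /fire ?e0 ?e1 ?e2.
Qed.

Lemma legal_lift n x v : 0 < n -> twisted_height n x ->
  legal n.*2 step4 (x \o emb n) (P_word n v) ->
  centre_legal n x [seq i <- v | i \in [:: n; n.+1; n.+2]] ->
  legal n.*2.+1 (twisted_step n) x v.
Proof.
move=> n0; elim: v x => //= i v IH x tx; rewrite /P_word /= !inE.
case: (eqVneq i n.+1) => [->|i1] /=.
  rewrite orbT /= eqxx /= => lv /and4P[_ _ fi cv].
  have fi' : fireable n.*2.+1 x n.+1 by rewrite fireable_centre.
  by rewrite fi' /=; apply: IH => //; [exact: twisted_fire | rewrite fire_centre].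
case/andP=> fi lv cv.
have [h0 [h2 cv']] : (i == n) ==> (x n < x n.+1)%R /\ (i == n.+2) ==> (x n.+2 < x n.+1)%R /\
    centre_legal n (fire (twisted_step n) i x) [seq i <- v | i \in [:: n; n.+1;
      n.+2]].
  move: cv; case ni0: (i == n).
    by rewrite /= ni0 /= => /and4P[-> -> _ ->].
  case ni2: (i == n.+2); first by rewrite /= ni0 ni2 /= => /and3P[-> _ ->].
  move=> /= cv; do 2!split=> //; rewrite -(@centre_legal_ext _ x) // /fire.
  - by rewrite eq_sym ni0.
  - by rewrite eq_sym (negPf i1).
  - by rewrite eq_sym ni2.
have fi' : fireable n.*2.+1 x i by rewrite fireable_outer // fi h0 h2.
by rewrite fi' /=; apply: IH => //; [exact: twisted_fire | rewrite fire_outer].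
Qed.

(** The higher one of the two central letters was fired last, so the other
one comes next. *)
Lemma legal_alternates n x u : 0 < n -> zigzag n.*2 x -> legal n.*2 step4 x u ->
  path (fun i j => i != j) (if (x n < x n.+1)%R then n.+1 else n)
    [seq i <- u | i \in [:: n; n.+1]].
Proof.
move=> n0; elim: u x => //= i u IH x zx /andP[fi lu].
have zc := zigzag_centre n0 zx; have := IH _ (zigzag_fire zx fi) lu.
have l0 : letter n.*2 n by rewrite /letter; lia.
have l1 : letter n.*2 n.+1 by rewrite /letter; lia.
rewrite !inE /fire /step4.
have n1 : (n.+1 == n) = false by lia.
have n2 : (n == n.+1) = false by lia.
have [e|ni0] := eqVneq i n.
  have := fireableS fi; rewrite e => /(_ l1) h.
  have q : (x n + 4%Z < x n.+1)%R = false by lia.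
  by rewrite n1 h q /= n1 => ->.
have [e|ni1] := eqVneq i n.+1.
  have := fireableP1 fi; rewrite e => /(_ l0) /= h.
  have q : (x n < x n.+1)%R = false by lia.
  have q' : (x n < x n.+1 + 4%Z)%R by lia.
  by rewrite ?n2 q q' ?orbT /= ?n2 => ->.
by [].
Qed.

(** After each letter [n] or [n+2] the letter [n+1] is pending again, and firing
it makes the other one of them the next letter. The word [t] is the optional
last letter [n+1]. *)
Lemma centre_legal_separate n x s t : 0 < n ->
  (x n.+2 = x n + 2 /\ x n.+1 = x n + 1 \/ x n = x n.+2 + 2 /\ x n.+1 = x n.+2 + 1)%R ->
  all (fun i => i \in [:: n; n.+2]) s ->
  path (fun i j => i != j) (if (x n < x n.+2)%R then n.+2 else n) s ->
  s != [::] -> t = [::] \/ t = [:: n.+1] ->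
  centre_legal n x (separate n.+1 s ++ t).
Proof.
move=> n0; elim: s x => // k s IH x cx /= /andP[ks ss] /andP[hk ps] _ ht.
have ex : (x k = if (x n < x n.+2)%R then x n else x n.+2) /\
    k = if (x n < x n.+2)%R then n else n.+2.
  move: ks hk; rewrite !inE; case: ifP => _ /orP[]/eqP ->; by rewrite ?eqxx.
pose y := fire (twisted_step n) n.+1 (fire (twisted_step n) k x).
have ky : (k == n.+1) = false by move: ks; rewrite !inE; lia.
have q : [/\ (n == n.+1) = false, (n.+2 == n.+1) = false, (n.+2 == n) = false,
   (n.+1 == n) = false & (n == n.+2) = false /\ (n.+1 == n.+2) = false].
  by do !split; lia.
case: q => q1 q2 q3 q4 [q5 q6].
have yc : [/\ (y n.+2 = y n + 2 /\ y n.+1 = y n + 1 \/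
    y n = y n.+2 + 2 /\ y n.+1 = y n.+2 + 1)%R,
    (if (y n < y n.+2)%R then n.+2 else n) = k &
    pending n (fire (twisted_step n) k x)].
  rewrite /y /pending /fire /twisted_step eqxx.
  move: ks; rewrite !inE => /orP[]/eqP e; move: ex hk; rewrite e.
    rewrite eqxx ?(q1, q2, q3, q4, q5, q6).
    by case: ifP => h [_ hn] h'; split; try lia; rewrite ifF; lia.
  rewrite eqxx ?(q1, q2, q3, q4, q5, q6).
  by case: ifP => h [_ hn] h'; split; try lia; rewrite ifT; lia.
case: yc => cy hy pk.
have c0 : (k == n) ==> (x n < x n.+1)%R.
  by apply/implyP => /eqP e; move: ex; rewrite e; case: ifP; lia.
have c2 : (k == n.+2) ==> (x n.+2 < x n.+1)%R.
  by apply/implyP => /eqP e; move: ex; rewrite e; case: ifP; lia.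
case: s => [|l s] in IH ss ps *.
  rewrite /= c0 c2 ky; case: ht => -> //=.
  by rewrite pk eqxx q4 q6.
case/andP: (ps) => kl _; rewrite kl /= -/(separate _ _) c0 c2 ky pk eqxx.
rewrite q4 q6.
by apply: IH => //; rewrite hy.
Qed.

Lemma count_separate z s : z \notin s -> path (fun i j =>
  i != j) (head z s) (behead s) ->
  count_mem z (separate z s) = (size s).-1.
Proof.
elim: s => //= x s IH; rewrite inE negb_or => /andP[zx zs].
case: s => [|y s] in IH zs *; first by rewrite /= eq_sym (negPf zx).
move=> /= /andP[xy ps]; rewrite xy /= eq_sym (negPf zx) eqxx add0n add1n.
by have := IH zs ps; rewrite /= => ->.
Qed.

Lemma filter_separate z s : z \notin s ->
  [seq i <- separate z s | i != z] = s.
Proof.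
elim: s => //= x s IH; rewrite inE negb_or eq_sym => /andP[zx zs].
case: s => [|y s] in IH zs *; first by rewrite /= zx.
by rewrite /= zx filter_cat IH //; case: (x != y); rewrite /= ?eqxx.
Qed.

Lemma all_separate z s (p : pred nat) : p z -> all p s -> all p (separate z s).
Proof.
move=> pz; elim: s => //= x s IH /andP[px ps].
case: s => [|y s] in IH ps *; first by rewrite /= px.
by rewrite /= px all_cat IH // andbT all_nseq pz orbT.
Qed.

(** The insertion procedure prescribes the whole word on one set of letters
and its central letters on another one; this combines the two. *)
Lemma shuffle z (p : pred nat) u t : z \notin u -> p z = false ->
  [seq i <- t | i != z] = [seq i <- u | p i] ->
  all (fun i => p i || (i == z)) t ->
  exists2 v, [seq i <- v | i != z] = u & [seq i <- v | p i || (i == z)] = t.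
Proof.
move=> zu pz; have [k] := ubnP (size u + size t).
elim: k u t zu => // k IH u [|j t] zu; rewrite ltnS.
  case: u zu => [|i u] /=; first by exists [::].
  rewrite inE negb_or eq_sym => /andP[/negPf zi zu] sz.
  case pi: (p i) => // e _; have [||//|v hv hv'] := IH u [::] zu;
    [by move: sz => /=; lia | exact: e |].
  by exists (i :: v); rewrite /= ?pi zi /= ?hv.
case: (eqVneq j z) => [->|jz] /=.
  rewrite eqxx addnS => sz e /andP[_ pt].
  have [||//|v hv hv'] := IH u t zu; [exact: sz | exact: e |].
  by exists (z :: v); rewrite /= eqxx //= ?hv // orbT hv'.
case: u zu => [|i u] /=; first by rewrite jz.
rewrite inE negb_or eq_sym => /andP[/negPf zi zu] sz; rewrite ?jz (negPf jz) ?orbF.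
case pi: (p i) => e /andP[pj pt].
  case: e => <- e; have [||//|v hv hv'] := IH u t zu; [by move: sz => /=;
    lia | exact: e |].
  by exists (j :: v); rewrite /= ?jz ?hv // pj hv'.
have [|||v hv hv'] := IH u (j :: t) zu; [by move: sz => /=;
  lia | by rewrite /= jz | |].
  by rewrite /= (negPf jz) orbF pj.
by exists (i :: v); rewrite /= ?pi zi /= ?hv.
Qed.

Lemma relabel_map n u : relabel n u = map (emb n) u.
Proof. by []. Qed.

Lemma P_filter n w : P_word n w = map (collapse n) [seq i <- w | i != n.+1].
Proof. by []. Qed.

Lemma centre_relabel n u : [seq i <- relabel n u | i \in [:: n; n.+2]] =
  map (emb n) [seq i <- u | i \in [:: n; n.+1]].
Proof.
rewrite relabel_map filter_map; congr map; apply: eq_filter => i /=.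
by rewrite !inE /emb; case: (ltnP n i); lia.
Qed.

Lemma notin_relabel n u : n.+1 \notin relabel n u.
Proof. by apply/mapP => -[i _ /esym/eqP]; rewrite -/(emb n i) emb_neq. Qed.

Lemma lifted_exists n b u : exists w, lifted n b u w.
Proof.
pose s := [seq i <- relabel n u | i \in [:: n; n.+2]].
have zs : n.+1 \notin s by rewrite mem_filter (negPf (notin_relabel n u)) andbF.
have [||||v hv hv'] := @shuffle n.+1 (fun i => i \in [:: n; n.+2])
  (relabel n u) (separate n.+1 s).
- exact: notin_relabel.
- by rewrite !inE; lia.
- by rewrite filter_separate.
- apply: all_separate; first by rewrite eqxx orbT.
  by apply/allP => i; rewrite mem_filter => /andP[->].
exists (if b then n.+1 :: v else rcons v n.+1); exists v => //; split=> //.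
rewrite -hv'; apply: eq_filter => i; rewrite !inE.
by do !case: eqP.
Qed.

Lemma lifted_P n b u w : lifted n b u w -> P_word n w = u.
Proof.
case=> v [hv _] ->.
have vu : P_word n v = u.
  rewrite P_filter hv relabel_map -map_comp -[RHS]map_id.
  by apply: eq_map => i /=; rewrite embK.
by case: b; rewrite -?cats1 P_filter ?filter_cat /= eqxx ?cats0.
Qed.

Lemma count_P n i w : i != n.+1 ->
  count_mem (collapse n i) (P_word n w) = count_mem i w.
Proof.
move=> i1; rewrite P_filter count_map count_filter; apply: eq_count => j /=.
case: (eqVneq j n.+1) => [->|j1]; first by rewrite andbF eq_sym (negPf i1).
rewrite andbT; apply/eqP/eqP => [h|->//].
by rewrite -(collapseK j1) h collapseK.
Qed.

(** The central letters [n] and [n+2] of [u] alternate, and there are [2n+1] of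
them. So [2n] letters [n+1] are inserted between them, and the one at the
beginning or at the end makes up the number that the centre requires. *)
Lemma lifted_twisted n b x u w : 0 < n -> zigzag n.*2 x ->
  zigzag_class n x u -> lifted n b u w ->
  twisted_class n (lift_height n b x) w.
Proof.
move=> n0 zx xu hw; have wu := lifted_P hw; case: hw => v [hv hs] we.
pose s := [seq i <- relabel n u | i \in [:: n; n.+2]]; rewrite -/s in hs.
have tx := lift_twisted b n0 zx; case: (xu) => lu cu.
have [c0 c2 c1] := lift_centre n b x.
have alt := legal_alternates n0 zx lu.
have zs : n.+1 \notin s by rewrite mem_filter (negPf (notin_relabel n u)) andbF.
have ps : path (fun i j => i != j) (if (x n < x n.+1)%R then n.+2 else n) s.
  rewrite /s centre_relabel (_ : (if _ then n.+2 else n) =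
    emb n (if (x n < x n.+1)%R then n.+1 else n)); last first.
    by rewrite /emb; case: ifP => _; rewrite ?leqnn ?ltnn.
  rewrite path_map; apply: sub_path alt => i j /=.
  by apply: contra_neq => /(can_inj (@embK n)).
have sall : all (fun i => i \in [:: n; n.+2]) s.
  by apply/allP => i; rewrite mem_filter => /andP[].
have ln : letter n.*2 n by rewrite /letter; lia.
have ln1 : letter n.*2 n.+1 by rewrite /letter; lia.
have ss : size s = n.*2.+1.
  rewrite /s centre_relabel size_map size_filter.
  rewrite (@eq_count _ _ (predU (pred1 n) (pred1 n.+1))) => [|i];
    last by rewrite !inE.
  have := count_predUI (pred1 n) (pred1 n.+1) u.
  rewrite (@eq_count _ (predI _ _) pred0) ?count_pred0 => [|i /=]; last first.
    by case: eqP => // ->; lia.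
  rewrite addn0 => ->; have := cu n ln; have := cu n.+1 ln1.
  have [e1 e2] : star n.*2 n = n.+1 /\ star n.*2 n.+1 = n by rewrite /star; lia.
  by rewrite /opposite /step4 e1 e2; lia.
have s0 : s != [::] by rewrite -size_eq0 ss.
split; last first.
  move=> i mi; case: (eqVneq i n.+1) => [->|i1]; last first.
    have mc := collapse_letter mi i1.
    have := cu _ mc; rewrite -wu count_P // -{1}(lift_emb n b x) -opposite_emb //=.
    rewrite collapseK // => ->; rewrite /twisted_step (negPf i1).
    by rewrite [in RHS]/lift_height (negPf i1).
  have -> : count_mem n.+1 w = n.*2.+1.
    have : count_mem n.+1 v = n.*2.
      rewrite -[RHS]/(n.*2.+1.-1) -ss -(count_separate zs); last first.
        by case: (s) ps => //= ? ? /andP[].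
      rewrite -hs count_filter; apply: eq_count => j /=.
      by case: eqP => // ->; rewrite !inE eqxx orbT.
    by rewrite we; case: (b); rewrite -?cats1 ?count_cat /= eqxx => ->; lia.
  by rewrite /opposite /twisted_step eqxx; have [-> _ _] := star_centre n.
apply: legal_lift => //; first by rewrite lift_emb wu.
have zc := zigzag_centre n0 zx.
rewrite we; case: (b) tx c0 c2 c1 => tx c0 c2 c1; last first.
  rewrite filter_rcons !inE eqxx orbT hs -cats1.
  apply: centre_legal_separate => //; last by right.
    by rewrite c0 c1 c2; case: ifP => h; lia.
  by rewrite c0 c2.
rewrite /= !inE eqxx orbT /= hs lift_pending // eqxx.
have [e1 e2] : (n.+1 == n) = false /\ (n.+1 == n.+2) = false by lia.
rewrite e1 e2 -(cats0 (separate _ _)) /=.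
have fE : [/\ fire (twisted_step n) n.+1 (lift_height n true x) n = x n,
  fire (twisted_step n) n.+1 (lift_height n true x) n.+2 = x n.+1 &
  fire (twisted_step n) n.+1 (lift_height n true x) n.+1 =
    ((if x n < x n.+1 then x n else x n.+1) + 1)%R].
  rewrite /fire /twisted_step eqxx c0 c1 c2 (_ : (n == n.+1) = false); last by lia.
  by rewrite (_ : (n.+2 == n.+1) = false); [split=> //; lia | lia].
case: fE => f0 f2 f1.
apply: centre_legal_separate => //; last by left.
  by rewrite f0 f1 f2; case: ifP => h; lia.
by rewrite f0 f2.
Qed.

(** * Words of the twisted cluster are reduced *)

(** In the wiring diagram one wire stays at the centre, being moved by the
letters [n+1] only; the other ones behave as in type [A_{2n}]. *)
Definition central_wire (n : nat) (x : height) : nat :=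
  if x n.+1 == (x n - 1)%R then n.+1 else n.+2.

(** The central wire gets the phase [s]; for the other wires the positions are
renumbered by leaving out that of the central wire. *)
Definition twisted_phase (n : nat) (s : int) (x : height) (p : nat) : int :=
  if p == central_wire n x then s
  else phase n.*2 (x \o emb n) (collapse n.+1 p).

Lemma collapse_swap n x i p : 0 < n -> twisted_height n x ->
  fireable n.*2.+1 x i -> i != n.+1 ->
  [/\ central_wire n (fire (twisted_step n) i x) = central_wire n x,
      swap i (central_wire n x) = central_wire n x &
      p != central_wire n x ->
      swap (collapse n i) (collapse n.+1 p) = collapse n.+1 (swap i p)].
Proof.
move=> n0 [zx cx] fi i1; rewrite fireable_outer // in fi.
case/and3P: fi => /fireable_letter mi h0 h2.
have {}mi : 0 < i by move: mi; rewrite /letter /collapse; case: (leqP i n); lia.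
have f1 : fire (twisted_step n) i x n.+1 = x n.+1 by rewrite /fire eq_sym (negPf i1).
have f0 : fire (twisted_step n) i x n = (x n + if i == n then 4 else 0)%R.
  rewrite /fire eq_sym; case: eqP => _; last by rewrite addr0.
  by rewrite /twisted_step ltn_eqF.
have [[cw e]|[cw e]] : central_wire n x = n.+1 /\ x n.+1 = (x n - 1)%R \/
    central_wire n x = n.+2 /\ x n.+1 <> (x n - 1)%R.
- by rewrite /central_wire; case: eqP; [left | right].
- have ni0 : (i == n) = false by apply/negP => h; rewrite h /= in h0; lia.
  rewrite cw /central_wire f0 f1 ni0 addr0 e eqxx; split=> //.
    by rewrite /swap; do !case: eqP; lia.
  by rewrite /swap /collapse; case: (leqP p n.+1); case: (leqP i n) => a b;
    do ![case: ifP]; lia.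
have ni2 : (i == n.+2) = false by apply/negP => h; rewrite h /= in h2; lia.
rewrite cw /central_wire f0 f1; split.
- by case: ifP; case: eqP => //; move: h0; case: eqP => //= _ _; lia.
- by rewrite /swap; do !case: eqP; lia.
- by rewrite /swap /collapse; case: (leqP p n.+1); case: (leqP i n) => a b;
    do ![case: ifP]; lia.
Qed.

Lemma twisted_phase_fire n s x i p : 0 < n -> twisted_height n x ->
  fireable n.*2.+1 x i -> letter n.*2.+2 p ->
  eqmod (period n.*2) (twisted_phase n s (fire (twisted_step n) i x) p)
    (twisted_phase n s x (swap i p)).
Proof.
move=> n0 tx fi mp; rewrite /twisted_phase.
case: (eqVneq i n.+1) fi => [->|i1] fi.
  have -> : (swap n.+1 p == central_wire n x) =
      (p == central_wire n (fire (twisted_step n) n.+1 x)).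
    rewrite fireable_centre // in fi; case: tx => _ cx.
    have f1 : fire (twisted_step n) n.+1 x n.+1 = (x n.+1 + 2)%R by rewrite /fire /twisted_step eqxx.
    have f0 : fire (twisted_step n) n.+1 x n = x n by rewrite /fire ltn_eqF.
    rewrite /central_wire f0 f1 /swap.
    by do 2![case: (_ =P _ :> int)]; do !case: eqP; lia.
  rewrite fire_centre; case: ifP => h; first exact: eqmod_refl.
  rewrite (_ : collapse n.+1 (swap n.+1 p) = collapse n.+1 p);
    first exact: eqmod_refl.
  by rewrite /swap /collapse; do ![case: ifP]; lia.
have [-> sw csw] := collapse_swap p n0 tx fi i1.
rewrite -{2}sw (inj_eq (can_inj (swapK i))).
case: (eqVneq p) => h; first exact: eqmod_refl.
rewrite -csw // fire_outer //; apply: phase_fire; first exact: tx.1.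
  by move: fi; rewrite fireable_outer // => /and3P[].
by move: mp; rewrite /letter /collapse; case: ifP; lia.
Qed.

Lemma twisted_phase_leads n s x y w p : 0 < n -> twisted_height n x ->
  leads n.*2.+1 (twisted_step n) x y w -> letter n.*2.+2 p ->
  eqmod (period n.*2) (twisted_phase n s y p) (twisted_phase n s x (act w p)).
Proof.
move=> n0 + + mp; elim: w x => [|i w IH] x tx.
  case=> _ h; have yx i : letter n.*2.+1 i -> y i = x i.
    by move=> mi; rewrite h //= mulr0 addr0.
  rewrite /twisted_phase /central_wire !yx; try by rewrite /letter; lia.
  case: ifP => _; first exact: eqmod_refl.
  rewrite (@phase_ext _ (x \o emb n)); first exact: eqmod_refl.
  - by move: mp; rewrite /letter /collapse; case: ifP; lia.
  - by rewrite double_gt0.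
  - by move=> i mi; exact: yx (emb_letter mi).
case/leads_cons=> fi h /=; apply: eqmod_trans (IH _ (twisted_fire n0 tx fi) h) _.
by apply: twisted_phase_fire => //; rewrite act_letter //; case: h => /legal_letter.
Qed.

Lemma phase_even m x p : zigzag m x -> 0 < m -> letter m.+1 p ->
  exists k : int, phase m x p = (x 1%N + k * 2)%R.
Proof.
move=> zx m0 mp; have m1 : letter m 1 by rewrite /letter.
have ev i : letter m i -> exists k : int, x i = (x 1%N + k * 2)%R.
  move=> mi; have [k ->] := zigzag_mod4 zx m1 mi.
  by exists (i%:Z - 1 + k * 2)%R; lia.
rewrite /phase; case: ifP => h.
  have [|k ->] := ev p; first by move: mp h; rewrite /letter; lia.
  by exists (k - p%:Z)%R; lia.
have [|k ->] := ev p.-1; first by move: mp h; rewrite /letter; case: eqP; lia.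
by exists (k + p.-1%:Z)%R; lia.
Qed.

(** The phases of the other wires have the parity of the height of the letter 1, so
an odd phase relative to it distinguishes the central wire. *)
Lemma twisted_phase_inj n x p q : 0 < n -> twisted_height n x ->
  letter n.*2.+2 p -> letter n.*2.+2 q ->
  eqmod (period n.*2) (twisted_phase n (x 1%N + 1)%R x p)
    (twisted_phase n (x 1%N + 1)%R x q) -> p = q.
Proof.
move=> n0 [zx cx] mp mq; rewrite /twisted_phase.
have n2 : 0 < n.*2 by rewrite double_gt0.
have lc r : letter n.*2.+2 r -> letter n.*2.+1 (collapse n.+1 r).
  by rewrite /letter /collapse; case: ifP; lia.
have x1 : (x \o emb n) 1 = x 1 by rewrite /= /emb ltnNge n0.
have odd_even r : letter n.*2.+2 r ->
    ~ eqmod (period n.*2) (x 1%N + 1)%R (phase n.*2 (x \o emb n) (collapse n.+1 r)).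
  move=> mr [k]; have [l ->] := phase_even zx n2 (lc r mr).
  by rewrite x1 /period => e; lia.
case: eqP => [ep|np]; case: eqP => [eq|nq]; first by rewrite ep eq.
- by move/odd_even => /(_ mq).
- by move/eqmod_sym/odd_even => /(_ mp).
move/(phase_inj zx (lc p mp) (lc q mq)) => e.
move: np nq e; rewrite /central_wire /collapse.
by case: eqP => _; do 2![case: ifP]; lia.
Qed.

Lemma twisted_phase_star n s x p : 0 < n -> twisted_height n x ->
  letter n.*2.+2 p ->
  eqmod (period n.*2)
    (twisted_phase n s (opposite n.*2.+1 (2 * n.*2.+1%:Z) x) p)
    (twisted_phase n s x (star n.*2.+2 p)).
Proof.
move=> n0 tx mp; rewrite /twisted_phase.
have -> : (p == central_wire n (opposite n.*2.+1 (2 * n.*2.+1%:Z) x)) =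
    (star n.*2.+2 p == central_wire n x).
  case: tx => _ cx; rewrite /central_wire /opposite; have [-> _ ->] := star_centre n.
  move: mp; rewrite /letter /star.
  by do 2![case: (_ =P _ :> int)]; do !case: eqP; lia.
case: ifP => _; first exact: eqmod_refl.
have n2 : 0 < n.*2 by rewrite double_gt0.
have lc : letter n.*2.+1 (collapse n.+1 p).
  by move: mp; rewrite /letter /collapse; case: ifP; lia.
rewrite (_ : collapse n.+1 (star n.*2.+2 p) = star n.*2.+1 (collapse n.+1 p));
  last first.
  by move: mp; rewrite /letter /star /collapse; do 2![case: ifP]; lia.
apply: eqmod_trans (phase_star tx.1 n2 lc).
rewrite (@phase_ext _ (opposite n.*2 (2 * n.*2.+1%:Z) (x \o emb n))) //.
  exact: eqmod_refl.
by move=> i mi; rewrite opposite_emb.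
Qed.

Lemma twisted_reduced n x w : 0 < n -> twisted_height n x ->
  twisted_class n x w -> reduced_w0 n.*2.+1 w.
Proof.
move=> n0 tx hw; have [lw cw] := hw; have mw := legal_letter lw.
apply: reverses_reduced => // [p mp|].
  apply: (@twisted_phase_inj n x) => //.
  - by rewrite act_letter.
  - exact: star_letter.
  - apply: eqmod_trans (twisted_phase_star _ n0 tx mp).
    exact/eqmod_sym/(twisted_phase_leads _ n0 tx hw mp).
apply: double_inj; rewrite (double_size mw).
rewrite (@eq_big_seq _ _ _ _ _ _ (fun i => n.*2.+1 + (i == n.+1) * n.*2.+1)) =>
  [|i]; last first.
  rewrite mem_iota1 => mi; have := cw i mi; have := cw _ (star_letter mi).
  rewrite twisted_step_star // /opposite starK // /twisted_step;
    case: eqP => [->|_]; last by lia.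
  by have [-> _ _] := star_centre n; lia.
have mc : n.+1 \in iota 1 n.*2.+1 by rewrite mem_iota1 /letter; lia.
rewrite big_split /= (sum_pick (fun=> n.*2.+1) (iota_uniq _ _) mc).
have e : n.*2.+2 * n.*2.+1 = (n.+1 * n.*2.+1).*2 by lia.
rewrite big_const_seq count_predT iter_addn_0 [size _]/= size_iota.
by rewrite bin2 [_.-1]/= e doubleK; lia.
Qed.

(** * Products of distinct simple reflections *)

Lemma act_outside m w x : word_in m w -> ~~ letter m.+1 x -> act w x = x.
Proof.
elim: w => //= i w IH /andP[mi mw] mx; rewrite IH //.
by move: mi mx; rewrite /swap /letter; do !case: eqP; lia.
Qed.

Lemma act_le w i x : i \notin w -> (act w x <= i) = (x <= i).
Proof.
elim: w => //= j w IH; rewrite inE negb_or => /andP[ij /IH <-].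
by rewrite /swap; do !case: eqP; lia.
Qed.

Lemma rev_notin (i : nat) (w : word) : i \notin w -> i \notin rev w.
Proof. by rewrite mem_rev. Qed.

(** For distinct letters, the support and the order of neighbouring letters
can be read off the permutation: [i] occurs iff some point crosses from below
[i+1] to above [i], and such a point is carried on past [i+1] iff the letter
[i+1] is applied after [i], thus stands before it. *)
Lemma act_mem w i : uniq w ->
  i \in w <-> exists2 x, x <= i & i < act w x.
Proof.
move=> uw; split=> [iw|[x xi]]; last first.
  by apply: contraLR => iw; rewrite -leqNgt act_le.
case/splitPr: iw uw => u v; rewrite cat_uniq /= negb_or.
case/and3P=> _ /andP[iu _] /andP[iv _].
exists (act (rev v) i); first by rewrite act_le ?rev_notin.
by rewrite act_cat /= actVK /swap eqxx ltnNge act_le ?ltnn.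
Qed.

Lemma act_order w i : uniq w -> i \in w ->
  index i.+1 w < index i w <-> exists2 x, x <= i & i.+1 < act w x.
Proof.
move=> uw iw; case/splitPr: iw uw => u v; rewrite cat_uniq /= negb_or.
case/and3P=> uu /andP[iu _] /andP[iv _].
rewrite (index_cat i) (negPf iu) /= eqxx addn0; split=> [|[x xi]]; last first.
  case iu1: (i.+1 \in u); first by rewrite index_cat iu1 index_mem.
  rewrite ltnNge act_cat act_le ?iu1 //= => h; case/negP: h.
  by have := act_le x iv; rewrite xi /swap; do !case: eqP; lia.
rewrite index_cat; case: ifP => iu1; last by rewrite ltnNge leq_addr.
move=> _; case/splitPr: iu1 uu iu => p q uu;
  rewrite mem_cat inE !negb_or => /and3P[ip _ iq].
exists (act (rev v) i); first by rewrite act_le ?rev_notin.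
have {uu} [ip1 iq1] : i.+1 \notin p /\ i.+1 \notin q.
  by move: uu; rewrite cat_uniq /= negb_or => /and3P[_ /andP[-> _] /andP[-> _]].
rewrite -catA act_cat /= act_cat /= actVK {2}/swap eqxx.
have -> : act q i.+1 = i.+1.
  by have := act_le i.+1 iq; have := act_le i.+1 iq1; rewrite leqnn ltnn; lia.
by rewrite /swap eqxx ltnNge act_le ?ltnn // eq_sym.
Qed.

(** Both words have the same support and the same order of neighbouring letters,
so the first letter of one can be brought to the front of the other. *)
Lemma uniq_act_comm v w : uniq v -> uniq w -> act v =1 act w -> comm_eq v w.
Proof.
elim: v w => [|i v IH] w uv uw vw.
  case: w uw vw => [|i w] uw vw; first exact: comm_refl.
  have : i \in [::] by apply/(@act_mem [::]) => //;
    have [x xi h] := (act_mem i uw).1 (mem_head i w);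
    exists x => //; rewrite vw.
  by [].
have memE j : j \in (i :: v) <-> j \in w.
  by rewrite (act_mem j uv) (act_mem j uw); split=> -[x xj h]; exists x => //;
    [rewrite -vw | rewrite vw].
have iw : i \in w by apply/memE; exact: mem_head.
have wE : comm_eq w (i :: rem i w).
  apply: comm_front => // j jw; apply/negP => ij.
  have lt : index j w < index i w by exact: index_ltn.
  have {}jw : j \in w by rewrite -index_mem (ltn_trans lt) // index_mem.
  have orderE k : k \in w ->
      (index k.+1 w < index k w <-> index k.+1 (i :: v) < index k (i :: v)).
    move=> kw; rewrite (act_order uw) // (act_order uv); last exact/memE.
    by split=> -[x xk h]; exists x => //; [rewrite vw | rewrite -vw].
  case/orP: ij => /eqP e.
    have := (orderE i iw).1; rewrite -e => /(_ lt) /=; rewrite eqxx; lia.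
  have := (orderE j jw).2; rewrite -e /= eqxx.
  by case: eqP => [|_ /(_ isT)]; lia.
apply: comm_trans (comm_sym wE); apply: comm_cons; apply: IH.
- by case/andP: uv.
- exact: rem_uniq.
- by move=> x; have := vw x; rewrite (act_comm wE) /= => /(can_inj (swapK i)).
Qed.

(** * Twisted Coxeter words *)

(** A twisted Coxeter word leads from a height to its mirror image raised by 2.
Since a letter other than [n+1] is raised by 0 or 4, it differs by 2 from its
mirror image. *)
Definition coxeter_height (n : nat) (x : height) : Prop :=
  twisted_height n x /\
  forall i, letter n.*2 i -> (x (emb n (star n.*2 i)) = x (emb n i) + 2 \/
    x (emb n (star n.*2 i)) = x (emb n i) - 2)%R.

Definition coxeter_word (n : nat) (x : height) (w : word) : Prop :=
  leads n.*2.+1 (twisted_step n) x (opposite n.*2.+1 2 x) w.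

Lemma coxeter_star n x i : coxeter_height n x -> letter n.*2.+1 i -> i != n.+1 ->
  (x (star n.*2.+1 i) = x i + 2 \/ x (star n.*2.+1 i) = x i - 2)%R.
Proof.
move=> [_ h] mi i1; have mc := collapse_letter mi i1; have := h _ mc.
by rewrite emb_star // collapseK.
Qed.

Lemma coxeter_word_exists n x : 0 < n -> coxeter_height n x ->
  exists w, coxeter_word n x w.
Proof.
move=> n0 cx; have [tx _] := cx; apply: twisted_path => //.
- exact: twisted_opposite.
- move=> i mi; rewrite /opposite; case: (eqVneq i n.+1) => [->|i1].
    by have [-> _ _] := star_centre n; lia.
  by have := coxeter_star cx mi i1; lia.
- apply: twisted_congr => //; first exact: twisted_opposite.
  have [||e|e] := @coxeter_star n x 1 cx; rewrite ?/letter //; first by lia.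
    by exists 1%R; rewrite /opposite e; ring.
  by exists 0%R; rewrite /opposite e; ring.
Qed.

(** Of a letter and its mirror image, the lower one is fired once and the higher
one is not fired. *)
Lemma coxeter_transversal n x w : coxeter_height n x -> coxeter_word n x w ->
  vee_transversal n w.
Proof.
move=> cx [lw cw]; split; first exact: legal_letter lw.
move=> i mi; have ms : letter n.*2.+1 (vee n i) := star_letter mi.
have := cw i mi; have := cw _ ms; rewrite /opposite starK // twisted_step_star //.
case: (eqVneq i n.+1) => [->|i1].
  have [e _ _] := star_centre n; rewrite -[star _ _]/(vee n n.+1) in e.
  rewrite e /twisted_step eqxx => h _.
  rewrite (@eq_count _ _ (pred1 n.+1)); first by lia.
  by move=> j; rewrite !inE orbb.
have := coxeter_star cx mi i1;
  rewrite -[star _ i]/(vee n i) /twisted_step (negPf i1) => h h1 h2.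
have := count_predUI (pred1 i) (pred1 (vee n i)) w.
rewrite (@eq_count _ (predI _ _) pred0) ?count_pred0 => [|j /=]; last first.
  by apply/negP => /andP[/eqP -> /eqP e]; move: h; rewrite -e; lia.
rewrite addn0 => e; rewrite (@eq_count _ _ (predU (pred1 i) (pred1 (vee n i)))).
  by rewrite e; lia.
by move=> j; rewrite !inE.
Qed.

(** Successive blocks of the word lead through the mirror images, raised by
2 at each step. *)
Lemma coxeter_twisted n x w : coxeter_word n x w ->
  twisted_class n x (twisted_word n w).
Proof.
move=> hw; pose y k : height := fun i =>
  ((if odd k then x (star n.*2.+1 i) else x i) + 2 * k%:Z)%R.
have block k : leads n.*2.+1 (twisted_step n) (y k) (y k.+1) (vee_pow n k w).
  elim: k => [|k IH]; first by apply: leads_ext hw => i mi;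
    rewrite /y /opposite /=; ring.
  have := leads_shift 2 (leads_star (@twisted_step_star n) IH).
  apply: leads_ext => i mi; rewrite /y /=; case: (odd k); rewrite /= ?starK //; lia.
suff h K : leads n.*2.+1 (twisted_step n) (y 0) (y K)
    (flatten [seq vee_pow n k w | k <- iota 0 K]).
  by apply: leads_ext (h n.*2.+1) => i mi;
    rewrite /y /opposite /= ?odd_double /=; lia.
elim: K => [|K IH]; first exact: leads_nil.
rewrite (_ : iota 0 K.+1 = iota 0 K ++ [:: K]); last by rewrite -[K.+1]addn1 iotaD.
by rewrite map_cat flatten_cat /= cats0; apply: leads_cat IH (block K).
Qed.

Lemma count_le1_uniq (w : word) : (forall i, count_mem i w <= 1) -> uniq w.
Proof.
elim: w => //= i w IH h; apply/andP; split.
  by apply/count_memPn; have := h i; rewrite eqxx add1n ltnS leqn0 => /eqP.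
by apply: IH => j; apply: leq_trans (h j); exact: leq_addl.
Qed.

Lemma transversal_uniq n w : vee_transversal n w -> uniq w.
Proof.
case=> mw h; apply: count_le1_uniq => i; case mi: (letter n.*2.+1 i).
  by rewrite -(h i mi); apply: sub_count => j /= /eqP ->; rewrite eqxx.
have iw : i \notin w by apply: contraFN mi => /(allP mw).
by rewrite (count_memPn iw).
Qed.

(** When the letters are distinct, a neighbour has been raised at most once by
the time a letter is fired, so the order of the letters decides legality. *)
Lemma legal_uniq m d x w : uniq w -> word_in m w ->
  (forall i j, letter m j -> adjacent i j -> i \in w -> (x i < x j +
     if (j \in w) && (index j w < index i w)%N then d j else 0)%R) ->
  legal m d x w.
Proof.
elim: w x => //= k w IH x /andP[kw uw] /andP[mk mw] h; apply/andP; split.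
  apply/fireableP; split=> // j mj kj; have := h k j mj kj (mem_head _ _).
  by rewrite eqxx ltn0 andbF addr0.
apply: IH => // i j mj ij iw; have ik : i != k by apply: contraNneq kw => <-.
have := h i j mj ij; rewrite !inE iw orbT => /(_ isT).
rewrite /fire /= (negPf ik) (eq_sym k i) (negPf ik).
case: (eqVneq k j) => [<-|kj] /=; first by rewrite (negPf kw) /= addr0.
by rewrite ltnS.
Qed.

(** The pair of heights of the [k]-th letters on both sides, counted from the
centre. Its two entries differ by 2, and two adjacent pairs differ by a common
shift by 2 or by an exchange; the exchange means that the next letters of the
Coxeter word lie on different sides. *)
Fixpoint side_heights (s : bool) (e : nat -> nat) (k : nat) : int * int :=
  if k is k'.+1 then
    let: (l, r) := side_heights s e k' in
    match e k' with
    | 0 => (l - 2, r - 2)%R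
    | 1 => (r, l)
    | _ => (l + 2, r + 2)%R
    end
  else (0%R, if s then 2%Z else - 2%:Z)%R.

(** The bit [s] says that [n] rather than [n+2] occurs in the word, the bit [o] that
[n+1] stands before this letter. *)
Definition code_height (n : nat) (s o : bool) (e : nat -> nat) : height := fun j =>
  if j == n.+1 then ((if s then 0 else - 2%:Z) + (if o then - 1%:Z else 1))%R
  else if j <= n then (side_heights s e (n - j)).1
  else (side_heights s e (j - n.+2)).2.

Lemma side_gap s e k :
  ((side_heights s e k).2 = (side_heights s e k).1 + 2 \/
   (side_heights s e k).2 = (side_heights s e k).1 - 2)%R.
Proof.
elim: k => [|k IH] /=; first by case: s; lia.
by case: (side_heights s e k) IH => l r /=; case: (e k) => [|[|?]] /=; lia.
Qed.

Lemma side_step s e k :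
  ((side_heights s e k.+1).1 = (side_heights s e k).1 + 2 \/
   (side_heights s e k.+1).1 = (side_heights s e k).1 - 2)%R /\
  ((side_heights s e k.+1).2 = (side_heights s e k).2 + 2 \/
   (side_heights s e k.+1).2 = (side_heights s e k).2 - 2)%R.
Proof.
have /= := side_gap s e k.
by case: (side_heights s e k) => l r /=; case: (e k) => [|[|?]] /=; lia.
Qed.

Lemma code_left n s o e k : k <= n -> code_height n s o e (n - k) = (side_heights s e k).1.
Proof.
move=> kn; rewrite /code_height ltn_eqF ?ltnS ?leq_subr //.
by rewrite subKn.
Qed.

Lemma code_right n s o e k : code_height n s o e (n.+2 + k) = (side_heights s e k).2.
Proof.
rewrite /code_height gtn_eqF ?ltnS ?leq_addr // ifF; last by lia.
by rewrite addKn.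
Qed.

Lemma code_centre n s o e : code_height n s o e n.+1 =
  ((if s then 0 else - 2%:Z) + (if o then - 1%:Z else 1))%R.
Proof. by rewrite /code_height eqxx. Qed.

Lemma code_coxeter n s o e : coxeter_height n (code_height n s o e).
Proof.
have sub0 j : n - 0 = n by rewrite subn0.
have x0 := @code_left n s o e 0 (leq0n n); rewrite subn0 in x0.
have x2 := @code_right n s o e 0; rewrite addn0 in x2.
split; last first.
  move=> i mi; rewrite emb_star // /emb; case: (ltnP n i) => ni.
    have -> : star n.*2.+1 i.+1 = n - (i - n.+1).
      by move: mi; rewrite /star /letter; lia.
    rewrite code_left; last by move: mi; rewrite /letter; lia.
    have -> : i.+1 = n.+2 + (i - n.+1) by lia.
    by rewrite code_right; have := side_gap s e (i - n.+1); lia.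
  have -> : star n.*2.+1 i = n.+2 + (n - i) by move: mi; rewrite /star /letter; lia.
  rewrite code_right -{2 4}(subKn ni) code_left ?leq_subr //.
  by have := side_gap s e (n - i); lia.
split; last by rewrite x0 x2 code_centre /=; case: (s); case: (o); lia.
move=> i mi mi1; rewrite /= /emb; case: (ltngtP n i) => ni.
- have -> : n < i.+1 by lia.
  have -> : i.+2 = n.+2 + (i - n.+1).+1 by lia.
  have -> : i.+1 = n.+2 + (i - n.+1) by lia.
  by rewrite !code_right; have := side_step s e (i - n.+1); lia.
- have -> : n < i.+1 = false by lia.
  have e1 : code_height n s o e i = (side_heights s e (n - i.+1).+1).1.
    by rewrite -(@code_left n s o); [congr (code_height n s o e _); lia | lia].
  have e2 : code_height n s o e i.+1 = (side_heights s e (n - i.+1)).1.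
    by rewrite -(@code_left n s o); [congr (code_height n s o e _); lia | lia].
  by rewrite e1 e2; have := side_step s e (n - i.+1); lia.
- by rewrite -ni ltnSn x0 x2 /=; case: (s); lia.
Qed.

Definition orbit_letter (n : nat) (w : word) (k : nat) : nat :=
  if n - k \in w then n - k else n.+2 + k.

Definition side_code (n : nat) (w : word) (k : nat) : nat :=
  if (n - k \in w) == (n - k.+1 \in w) then
    if index (orbit_letter n w k.+1) w < index (orbit_letter n w k) w then 0
    else 2
  else 1.

Definition centre_code (n : nat) (w : word) : bool :=
  index n.+1 w < index (orbit_letter n w 0) w.

Lemma transversal_mem n w k : vee_transversal n w -> k < n ->
  (n.+2 + k \in w) = ~~ (n - k \in w).
Proof.
move=> tw kn; have uw := transversal_uniq tw.
have ne : n.+2 + k != n - k by lia.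
have [_ /(_ (n - k))] := tw; rewrite (_ : vee n (n - k) = n.+2 + k); last first.
  by rewrite /vee; lia.
have := count_predUI (pred1 (n - k)) (pred1 (n.+2 + k)) w.
rewrite (@eq_count _ (predI _ _) pred0) ?count_pred0 => [|j /=]; last first.
  by apply/negP => /andP[/eqP -> /eqP e]; move: ne; rewrite -e eqxx.
rewrite addn0 (@eq_count _ (predU _ _) (pred2 (n - k) (n.+2 + k))); last first.
  by move=> j; rewrite !inE.
move=> -> h; have : letter n.*2.+1 (n - k) by rewrite /letter; lia.
move=> /h; rewrite (count_uniq_mem (n - k) uw) (count_uniq_mem (n.+2 + k) uw).
by case: (n - k \in w); case: (n.+2 + k \in w).
Qed.

Lemma transversal_centre n w : vee_transversal n w -> n.+1 \in w.
Proof.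
move=> [_ /(_ n.+1)]; rewrite /letter => h; rewrite -has_pred1 has_count.
rewrite (_ : count_mem n.+1 w = 1) //; rewrite -h; last by lia.
have e : vee n n.+1 = n.+1 by rewrite /vee; lia.
by apply: eq_count => j /=; rewrite e orbb.
Qed.

Lemma index_total (w : word) i j : i \in w -> i != j ->
  ~~ (index i w < index j w) -> index j w < index i w.
Proof.
move=> iw ij; rewrite -leqNgt leq_eqVlt => /orP[/eqP e|//].
have jw : j \in w by rewrite -index_mem e index_mem.
by case/eqP: ij; rewrite -(nth_index 0 iw) -e nth_index.
Qed.

(** A change of side in the word and the exchange of the two heights go
together. *)
Lemma side_mem n w e k : vee_transversal n w -> k < n ->
  (forall j, j.+1 < n -> e j = side_code n w j) ->
  (n - k \in w) =
  ((side_heights (n \in w) e k).1 < (side_heights (n \in w) e k).2)%R.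
Proof.
move=> tw + eE; elim: k => [|k IH] kn; first by rewrite subn0 /=; case: (n \in w).
have /= := side_gap (n \in w) e k; have := IH (ltnW kn).
rewrite eE // /side_code.
case: (side_heights (n \in w) e k) => l r /= -> gap.
case: (index _ w < index _ w); case: (n - k.+1 \in w);
  by case: eqP => //= h; lia.
Qed.

(** The last inequality says that [a] has passed [b] when [b] is fired. *)
Definition precedes (d x : height) (w : word) (a b : nat) : Prop :=
  (x a < x b)%R /\
  (b \in w -> [/\ a \in w, index a w < index b w & (x b < x a + d a)%R]).

Lemma precedes_legal m d x w : (forall i, (0 < d i)%R) -> uniq w -> word_in m w ->
  (forall i, letter m i -> letter m i.+1 ->
     precedes d x w i i.+1 \/ precedes d x w i.+1 i) ->
  legal m d x w.
Proof.
move=> d0 uw mw h; apply: legal_uniq => // i j mj ij iw.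
have mi : letter m i := allP mw i iw.
have : precedes d x w i j \/ precedes d x w j i.
  by case/orP: ij => /eqP e; move: (h i) (h j); rewrite e in mi mj *; tauto.
have := d0 j; case=> d0j [[lt _]|[_ /(_ iw)[-> -> //]]].
by case: ifP; lia.
Qed.

Lemma coxeter_word_code n w e : 0 < n -> vee_transversal n w ->
  (forall k, k.+1 < n -> e k = side_code n w k) ->
  coxeter_word n (code_height n (n \in w) (centre_code n w) e) w.
Proof.
move=> n0 tw eE; set x := code_height _ _ _ _.
have uw := transversal_uniq tw; have [mw _] := tw.
have xl k : k < n -> x (n - k) = (side_heights (n \in w) e k).1.
  by move=> kn; apply: code_left; exact: ltnW.
have xr k : x (n.+2 + k) = (side_heights (n \in w) e k).2 by exact: code_right.
have cw := transversal_centre tw.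
have mem k : k < n -> (n.+2 + k \in w) = ~~ (n - k \in w).
  by move=> kn; exact: transversal_mem.
have lm k : k < n -> (n - k \in w) = (x (n - k)%N < x (n.+2 + k)%N)%R.
  by move=> kn; rewrite xl // xr; exact: side_mem.
have gap k : k < n -> (x (n.+2 + k)%N = x (n - k)%N + 2 \/ x (n.+2 + k)%N = x (n - k)%N - 2)%R.
  by move=> kn; rewrite xl // xr; exact: side_gap.
have d4 i : i != n.+1 -> twisted_step n i = 4 by rewrite /twisted_step => /negPf ->.
have d2 : twisted_step n n.+1 = 2 by rewrite /twisted_step eqxx.
split.
  apply: precedes_legal => // [|i mi mi1]; first exact: twisted_step_gt0.
  case: (ltngtP i n) => [lt|gt|->].
  - pose k := n - i.+1; have kn : k.+1 < n by move: mi; rewrite /k /letter; lia.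
    have -> : i.+1 = n - k by rewrite /k; lia.
    have -> : i = n - k.+1 by rewrite /k; lia.
    have kn' := ltnW kn; have := eE k kn; have := lm k kn'; have := lm k.+1 kn.
    rewrite /precedes !d4; try by lia.
    have := @index_total w (n - k.+1) (n - k).
    rewrite !xl // !xr /side_code /orbit_letter /=.
    have := side_gap (n \in w) e k.
    case: (side_heights (n \in w) e k) => l r /= gp it.
    case ka: (n - k \in w); case kb: (n - k.+1 \in w) => /= h1 /esym h0;
      [case: ifP => ix ek | move=> ek | move=> ek | case: ifP => ix ek];
      rewrite ek /= {h1 ek}.
    + by left; split=> [|_]; [lia | split=> //; lia].
    + right; split=> [|_]; [lia | split=> //; [|lia]].
      by apply: it; rewrite ?ix //; lia.
    + by right; split=> //; lia.
    + by left; split=> //; lia.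
    + by left; split=> //; lia.
    + by right; split=> //; lia.
  - case: (eqVneq i n.+1) => [->|i1].
      have := lm 0 n0; have := mem 0 n0.
      rewrite /precedes (d4 n.+2) ?d2; last by lia.
      have -> : x n.+2 = (if n \in w then 2%Z else - 2%:Z)%R by rewrite -(addn0 n.+2) xr.
      rewrite /x code_centre /centre_code /orbit_letter subn0 addn0 => nw _.
      have := @index_total w n.+2 n.+1.
      case: (n \in w) nw => /= nw it; first by left; rewrite nw; split=> //;
        case: ifP; lia.
      case: ifP => ix; [left | right]; split=> //; try lia; move=> _;
        split=> //; try lia.
    pose k := i - n.+2; have kn : k.+1 < n by move: mi1; rewrite /k /letter; lia.
    have -> : i.+1 = n.+2 + k.+1 by rewrite /k; lia.
    have -> : i = n.+2 + k by rewrite /k; lia.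
    have kn' := ltnW kn; have := eE k kn; have := lm k kn'; have := lm k.+1 kn.
    have := mem k kn'; have := mem k.+1 kn.
    rewrite /precedes !d4; try by lia.
    have := @index_total w (n.+2 + k.+1) (n.+2 + k).
    rewrite !xl // !xr /side_code /orbit_letter /=.
    have := side_gap (n \in w) e k.
    case: (side_heights (n \in w) e k) => l r /= gp it.
    case ka: (n - k \in w); case kb: (n - k.+1 \in w) => /= mb ma h1 /esym h0;
      [case: ifP => ix ek | move=> ek | move=> ek | case: ifP => ix ek];
      rewrite ek /= {h1 ek}.
    + by right; split=> [|]; [lia | rewrite ma].
    + by left; split=> [|]; [lia | rewrite mb].
    + by right; split=> [|]; [lia | rewrite ma].
    + by left; split=> [|]; [lia | rewrite mb].
    + by right; split=> [|_]; [lia | split=> //; lia].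
    + left; split=> [|_]; [lia | split=> //; [|lia]].
      by apply: it; rewrite ?ix //; lia.
  - rewrite /precedes (d4 n) ?d2; last by lia.
    have -> : x n = 0%R by have := xl 0 n0; rewrite subn0.
    have := @index_total w n.+1 n; have := @transversal_mem n w 0 tw n0.
    rewrite /x code_centre /centre_code /orbit_letter subn0 addn0.
    case: (n \in w) => /= nw it; last by case: ifP; [right | right]; split=> //; lia.
    case: ifP => ix; [right | left]; split=> //; try lia; move=> _; split=> //;
      try lia.
    by apply: it; rewrite ?ix //; lia.
move=> i mi; rewrite (count_uniq_mem _ uw) /opposite.
case: (ltngtP i n.+1) => [lt|gt|->].
- pose k := n - i; have kn : k < n by move: mi; rewrite /k /letter; lia.
  have iE : i = n - k by rewrite /k; lia.
  have -> : star n.*2.+1 i = n.+2 + k by rewrite /star iE; lia.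
  rewrite iE lm // d4; last by lia.
  by have := gap k kn; case: ltP => /= h; lia.
- pose k := i - n.+2; have kn : k < n by move: mi; rewrite /k /letter; lia.
  have iE : i = n.+2 + k by rewrite /k; lia.
  have -> : star n.*2.+1 i = n - k by rewrite /star iE; lia.
  rewrite iE mem // lm // d4; last by lia.
  by have := gap k kn; case: ltP => /= h; lia.
- by have [-> _ _] := star_centre n; rewrite cw d2.
Qed.

Definition word_code (n : nat) (w : word) : n.-1.-tuple 'I_3 :=
  [tuple inord (side_code n w k) | k < n.-1].

Definition code_fun (n : nat) (c : bool * bool * n.-1.-tuple 'I_3) : height :=
  code_height n c.1.1 c.1.2 (fun k => nth ord0 c.2 k).

Lemma transversal_coxeter n w : 0 < n -> vee_transversal n w ->
  exists c, coxeter_word n (@code_fun n c) w.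
Proof.
move=> n0 tw; exists (n \in w, centre_code n w, word_code n w).
apply: coxeter_word_code => // k kn; have kn' : k < n.-1 by lia.
rewrite -[k]/(val (Ordinal kn')) /= -[X in nth _ _ X]/(val (Ordinal kn')).
rewrite nth_mktuple inordK // /side_code.
by case: ifP => // _; case: ifP.
Qed.

(** The three options at each step change the sum of the pair of heights by -4, 0
and 4, hence differ even up to translation. *)
Lemma code_fun_inj n (c c' : bool * bool * n.-1.-tuple 'I_3) k : 0 < n ->
  (forall i, letter n.*2.+1 i -> code_fun c' i = (code_fun c i + k)%R) -> c = c'.
Proof.
move=> n0 h; case: c c' h => [[s o] t] [[s' o'] t']; rewrite /code_fun /= => h.
set e' := (fun k => _) in h; set e := (fun k => _) in h.
have hl j : j < n -> (side_heights s' e' j).1 = ((side_heights s e j).1 + k)%R.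
  move=> jn; have := h (n - j); rewrite !code_left; try by lia.
  by apply; rewrite /letter; lia.
have hr j : j < n -> (side_heights s' e' j).2 = ((side_heights s e j).2 + k)%R.
  move=> jn; have := h (n.+2 + j); rewrite !code_right.
  by apply; rewrite /letter; lia.
have k0 : k = 0%R by have := hl 0 n0; rewrite /=; lia.
have ss : s = s' by have := hr 0 n0; rewrite k0 /=; case: (s); case: (s').
have oo : o = o'.
  have := h n.+1; rewrite !code_centre ss k0 /letter => H.
  by have {H} := H ltac:(lia); case: (o); case: (o'); lia.
congr (_, _, _); try done; apply: eq_from_tnth => i.
have ilt := ltn_ord i; have il : i < n by lia.
have il1 : i.+1 < n by lia.
apply: val_inj; rewrite /= !(tnth_nth ord0) -/(e i) -/(e' i).
have := hl _ il1; have := hr _ il1; have := hl _ il; have := hr _ il; rewrite k0 /=.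
have e3 : e i < 3 := ltn_ord _; have e3' : e' i < 3 := ltn_ord _.
case: (side_heights s e i) => l r; case: (side_heights s' e' i) => l' r' /=.
move: e3 e3'; case: (e i) => [|[|[|?]]] //; case: (e' i) => [|[|[|?]]] //= _ _; lia.
Qed.

(** * Matrices of twisted Coxeter elements *)

Lemma coset_mxE n w k j :
  coset_mx n w k j = word_mx n.*2.+1 w k (rev_ord j).
Proof.
rewrite mxE (bigD1 (rev_ord j)) //= big1 ?addr0 => [|l lj]; rewrite mxE /=.
  by rewrite (_ : _ == _ = true) ?mulr1 // /vee; have := ltn_ord j; lia.
rewrite (_ : _ == _ = false) ?mulr0 //; apply/negP => /eqP e.
by case/eqP: lj; apply: val_inj; rewrite /=; move: e; rewrite /vee; lia.
Qed.

Lemma coset_comm n v w : vee_transversal n v -> vee_transversal n w ->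
  coset_mx n v = coset_mx n w <-> comm_eq v w.
Proof.
move=> tv tw; have [[mv _] [mw _]] := (tv, tw).
have cosetE : coset_mx n v = coset_mx n w <->
    word_mx n.*2.+1 v = word_mx n.*2.+1 w.
  split=> [vw|vw]; last by rewrite /coset_mx vw.
  by apply/matrixP => k j; rewrite -(rev_ordK j) -!coset_mxE vw.
rewrite cosetE word_mx_act //; split=> [vw|/act_comm vw x _]; last exact: vw.
apply: uniq_act_comm; [exact: transversal_uniq tv | exact: transversal_uniq tw |].
move=> x; case mx: (letter n.*2.+2 x); first exact: vw.
by rewrite !(@act_outside n.*2.+1) ?mx.
Qed.

Lemma iota_transversal n : vee_transversal n (iota 1 n.+1).
Proof.
split; first by apply/allP => i; rewrite mem_iota1 /letter; lia.
move=> i mi; pose r := if i <= n.+1 then i else vee n i.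
have mr : r \in iota 1 n.+1.
  by rewrite mem_iota1 /r; move: mi; rewrite /letter /vee; case: ifP; lia.
rewrite (@eq_in_count _ _ (pred1 r)) ?count_uniq_mem ?iota_uniq ?mr // => j.
rewrite mem_iota1 /= /r; move: mi; rewrite /letter /vee.
by case: ifP => h; do !case: eqP; lia.
Qed.

Lemma twisted_clusterE n : 0 < n -> twisted_cluster n =
  [set c | exists2 x, twisted_height n x & c = twisted_class n x].
Proof.
move=> n0; have [c hc] := transversal_coxeter n0 (iota_transversal n).
apply: (cluster_point_twisted n0 _ (coxeter_twisted hc)).
by have [] := @code_coxeter n c.1.1 c.1.2 (fun k => nth ord0 c.2 k).
Qed.

(** * Counting *)

Lemma card_range (T : finType) (U : Type) (f : T -> U) :
  injective f -> range f #= `I_#|T|.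
Proof.
move=> fi; rewrite (_ : range f = (f \o enum_val) @` [set: 'I_#|T|]).
  apply: card_eq_trans (card_esym card_II).
  by apply: inj_card_eq => i j _ _ /fi/enum_val_inj.
apply/seteqP; split=> u /= [x _ <-]; last by exists (enum_val x).
by exists (enum_rank x); rewrite //= enum_rankK.
Qed.

Definition bit_height (e : nat -> bool) : height :=
  fix x i := if i is k.+1 then (x k + if e k then 2 else - 2%:Z)%R else 0%R.

Lemma bit_zigzag m e : zigzag m (bit_height e).
Proof. by move=> i _ _ /=; case: (e i); [left | right]. Qed.

Lemma zigzag_bits m x e : zigzag m x ->
  (forall i, letter m i -> letter m i.+1 -> e i = (x i < x i.+1)%R) ->
  forall i, letter m i -> x i = (bit_height e i + (x 1%N - bit_height e 1%N))%R.
Proof.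
move=> zx he; elim=> // i IH mi; case: (posnP i) => [->|i0]; first by ring.
have li : letter m i by move: mi; rewrite /letter; lia.
have := IH li; have := zx i li mi; have := he i li mi.
by rewrite /=; case: (e i); lia.
Qed.

(** The bits at positions from 1 on describe the differences of neighbouring
heights. The bit at position 0 says whether [n+1] is pending; its contribution
to the heights is a common translation. *)
Definition bit_class (n : nat) (t : n.*2.-tuple bool) : set word :=
  twisted_class n (lift_height n (nth false t 0) (bit_height (nth false t))).

Lemma twisted_cluster_bits n : 0 < n -> twisted_cluster n = range (@bit_class n).
Proof.
move=> n0; rewrite twisted_clusterE //; apply/seteqP; split=> c /=; last first.
  case=> t _ <-; eexists; last by [].
  by apply: lift_twisted => //; exact: bit_zigzag.
case=> x tx ->.
pose f i := if i == 0 then pending n x else (x (emb n i) < x (emb n i.+1))%R.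
pose t := [tuple f i | i < n.*2]; exists t => //.
rewrite /bit_class; set e := nth false t.
have eE i : i < n.*2 -> e i = f i.
  by move=> ilt; rewrite /e /t -[i]/(val (Ordinal ilt)) nth_mktuple.
rewrite eE ?double_gt0 // {1}/f eqxx; apply/esym.
apply: (@twisted_class_lift n x _ (x (emb n 1) - bit_height e 1%N)%R) => //.
  exact: bit_zigzag.
apply: (@zigzag_bits n.*2 (x \o emb n)) => [|i mi mi1]; first exact: tx.1.
rewrite eE /f ?ifF //; by move: mi mi1; rewrite /letter; lia.
Qed.

Lemma pending_shift n x y k : 0 < n ->
  (forall i, letter n.*2.+1 i -> y i = (x i + k)%R) -> pending n y = pending n x.
Proof.
by move=> n0 h; rewrite /pending !h ?ltrD2r // /letter; lia.
Qed.

Lemma bit_class_inj n : 0 < n -> injective (@bit_class n).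
Proof.
move=> n0 t t'; rewrite /bit_class.
set e := nth false t; set e' := nth false t' => h.
have z := @bit_zigzag n.*2 e; have z' := @bit_zigzag n.*2 e'.
have [k hk] := twisted_class_inj n0 (lift_twisted _ n0 z) (lift_twisted _ n0 z') h.
have e0 : e 0 = e' 0.
  by have := pending_shift n0 hk; rewrite !lift_pending // => ->.
have xk i : letter n.*2 i -> bit_height e' i = (bit_height e i + k)%R.
  by move=> mi; have := hk _ (emb_letter mi); rewrite /lift_height !emb_neq !embK.
apply: eq_from_tnth => i; rewrite !(tnth_nth false) -/(e i) -/(e' i).
case: (posnP i) => [->//|i0].
have ilt := ltn_ord i.
have h0 : bit_height e' i = (bit_height e i + k)%R by apply: xk; rewrite /letter; lia.
have : bit_height e' i.+1 = (bit_height e i.+1 + k)%R by apply: xk;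
  rewrite /letter; lia.
by rewrite /= h0; case: (e i); case: (e' i) => //; lia.
Qed.

Lemma fiber_card n y : 0 < n -> zigzag n.*2 y ->
  [set twisted_class n (lift_height n true y);
       twisted_class n (lift_height n false y)] #= `I_2.
Proof.
move=> n0 zy; rewrite -card_bool.
rewrite (_ : [set _; _] = range (fun b => twisted_class n (lift_height n b y))).
  apply: card_range => b b' h.
  have [k hk] := twisted_class_inj n0 (lift_twisted b n0 zy) (lift_twisted b' n0 zy) h.
  by have := pending_shift n0 hk; rewrite !lift_pending.
apply/seteqP; split=> c /=; first by case=> ->; eexists.
by case=> -[] _ <-; [left | right].
Qed.

Lemma code_word_exists n c : 0 < n -> exists w, coxeter_word n (@code_fun n c) w.
Proof.
by move=> n0; apply: coxeter_word_exists => //; exact: code_coxeter.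
Qed.

(** Two bits describe the centre; for each of the [n-1] further orbits, its letter
stands on the other side than the previous one, or on the same side and before
or after it. *)
Lemma twisted_coxeter_card n : 0 < n -> @twisted_coxeter n #= `I_(4 * 3 ^ n.-1).
Proof.
move=> n0.
pose word_of c := sval (cid (@code_word_exists n c n0)).
have word_ofP c : coxeter_word n (code_fun c) (word_of c) by rewrite /word_of;
  case: cid.
have tr c w : coxeter_word n (@code_fun n c) w -> vee_transversal n w.
  by apply: coxeter_transversal; exact: code_coxeter.
rewrite (_ : @twisted_coxeter n = range (fun c => coset_mx n (word_of c))).
  rewrite (_ : 4 * 3 ^ n.-1 = #|{: bool * bool * n.-1.-tuple 'I_3}|); last first.
    by rewrite !card_prod card_tuple card_ord card_bool.
  apply: card_range => c c' /(coset_comm (tr _ _ (word_ofP c)) (tr _ _ (word_ofP c'))) h.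
  have hc := coxeter_twisted (leads_comm h (word_ofP c)).
  have hc' := coxeter_twisted (word_ofP c').
  have th (d : bool * bool * n.-1.-tuple 'I_3) : twisted_height n (code_fun d).
    by have [] := @code_coxeter n d.1.1 d.1.2 (fun k => nth ord0 d.2 k).
  have [k hk] : exists k : int, forall i, letter n.*2.+1 i ->
      code_fun c' i = (code_fun c i + k)%R.
    apply: (twisted_class_inj n0 (th c) (th c')).
    by rewrite (twisted_classE hc) (twisted_classE hc').
  exact: code_fun_inj hk.
apply/seteqP; split=> A /=; last first.
  by case=> c _ <-; exists (word_of c) => //; exact: tr (word_ofP c).
case=> w tw <-; have [c hc] := transversal_coxeter n0 tw.
exists c => //; apply/(coset_comm (tr _ _ (word_ofP c)) tw).
by apply: leads_uniq (word_ofP c) hc; exact: twisted_step_gt0.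
Qed.

(** Each arrow between [i] and [j] contributes its direction to the
difference of the heights. *)
Lemma arrows_sum m x q i j : zigzag m x -> q =2 quiver_of m x ->
  letter m i -> letter m j -> i <= j ->
  (x j - x i = 2 * ((\sum_(i <= k < j) q k.+1 k)%N%:Z -
                    (\sum_(i <= k < j) q k k.+1)%N%:Z))%R.
Proof.
move=> zx qx mi; elim: j => [|j IH] mj ij; first by move: mi mj; rewrite /letter; lia.
case: (eqVneq i j.+1) => [<-|ne]; first by rewrite !big_geq //; ring.
have ij' : i <= j by lia.
have mj' : letter m j by move: mi mj; rewrite /letter; lia.
rewrite !big_nat_recr //= !qx /quiver_of mj mj' /adjacent !eqxx /= orbT.
by have := IH mj' ij'; have := zx j mj' mj; do !case: ltP => /= *; lia.
Qed.

Lemma arrows_difference m x q i j : zigzag m x -> q =2 quiver_of m x ->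
  letter m i -> letter m j -> i != j ->
  (x j - x i = 2 * ((arrows_toward q i j)%:Z - (arrows_toward q j i)%:Z))%R.
Proof.
move=> zx qx mi mj; rewrite /arrows_toward; case: (ltngtP i j) => // ij _.
- by have := arrows_sum zx qx mi mj (ltnW ij); lia.
- by have := arrows_sum zx qx mj mi (ltnW ij); lia.
Qed.

Theorem theorem4p17 (n : nat) (n_ge1 : 1 <= n) :
  (* (1) *)
  [/\ forall w, twisted_cluster n (comm_class w) ->
        P_class n (comm_class w) = comm_class (P_word n w),
      set_fun (twisted_cluster n) (adapted_cluster n.*2) (P_class n),
      set_surj (twisted_cluster n) (adapted_cluster n.*2) (P_class n) &
      forall d, adapted_cluster n.*2 d ->
        [set c | twisted_cluster n c /\ P_class n c = d] #= `I_2]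
  (* (2) *)
  /\ (forall c, twisted_cluster n c ->
        (is_source c n.+1 \/ is_sink c n.+1) /\
        ~ (is_source c n.+1 /\ is_sink c n.+1))
  (* (3) *)
  /\ (forall q u, dynkin_quiver n.*2 q ->
        reduced_w0 n.*2 u -> adapted n.*2 q u ->
        [/\ forall b, exists w, lifted n b u w,
            forall b w w', lifted n b u w -> lifted n b u w' ->
              comm_class w = comm_class w' &
            forall w w', lifted n true u w -> lifted n false u w' ->
              comm_class w <> comm_class w' /\
              P_fiber n q = [set comm_class w; comm_class w']])
  (* (4) *)
  /\ twisted_cluster n #= `I_(2 ^ n.*2)
  (* (5) *)
  /\ @twisted_coxeter n #= `I_(4 * 3 ^ n.-1)
  (* (6) *)
  /\ ((forall w, vee_transversal n w ->
         reduced_w0 n.*2.+1 (twisted_word n w) /\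
         twisted_cluster n (comm_class (twisted_word n w))) /\
      (forall w w', vee_transversal n w -> vee_transversal n w' ->
         coset_mx n w = coset_mx n w' ->
         comm_class (twisted_word n w) = comm_class (twisted_word n w')))
  (* (7) *)
  /\ (forall w, vee_transversal n w ->
        exists2 q, dynkin_quiver n.*2 q &
          P_class n (comm_class (twisted_word n w)) = quiver_class n.*2 q /\
          forall i, 1 <= i <= n.*2 ->
            (`|(arrows_toward q i (n.*2.+1 - i))%:Z
               - (arrows_toward q (n.*2.+1 - i) i)%:Z| = 1)%R).
Proof.
have n0 : 0 < n := n_ge1.
have TE := twisted_clusterE n0.
have adaptedP d : adapted_cluster n.*2 d <->
    exists2 y, zigzag n.*2 y & d = zigzag_class n y.
  split=> [[q /quiver_height[y [zy qy]] ->]|[y zy ->]].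
    by exists y => //; exact: quiver_zigzag.
  exists (quiver_of n.*2 y); first exact: quiver_of_dynkin.
  by apply/esym/quiver_zigzag.
have fiberP y : zigzag n.*2 y ->
    [set c | twisted_cluster n c /\ P_class n c = zigzag_class n y] =
    [set twisted_class n (lift_height n true y);
         twisted_class n (lift_height n false y)].
  move=> zy; rewrite -(P_fiberE n0 zy (fun _ _ => erefl)) TE.
  by rewrite (quiver_zigzag n0 zy (fun _ _ => erefl)).
split; last split; last split; last split; last split; last split.
- split.
  + move=> w; rewrite TE /= => -[x tx wx].
    have hw : twisted_class n x w by rewrite -wx; exact: comm_refl.
    by rewrite wx P_class_twisted // (zigzag_classE (P_twisted n0 tx hw)).
  + move=> c; rewrite TE /= => -[x tx ->]; apply/adaptedP.
    by exists (x \o emb n); [exact: tx.1 | exact: P_class_twisted].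
  + move=> d /= /adaptedP[y zy ->]; have ty := lift_twisted true n0 zy.
    exists (twisted_class n (lift_height n true y)).
      by rewrite TE; exists (lift_height n true y).
    by rewrite P_class_twisted // lift_emb.
  + by move=> d /adaptedP[y zy ->]; rewrite fiberP //; exact: fiber_card.
- move=> c; rewrite TE /= => -[x tx ->].
  have sk := sink_centre n0 tx; have so := source_centre n0 tx.
  by split; [rewrite sk so | rewrite sk so => -[/negP]]; case: (pending n x); auto.
- move=> q u dq ru au; have [y [zy qy]] := quiver_height dq.
  have hu : zigzag_class n y u by rewrite -(quiver_zigzag n0 zy qy).
  have lift b w : lifted n b u w ->
      comm_class w = twisted_class n (lift_height n b y).
    by move/(lifted_twisted n0 zy hu)/twisted_classE.
  split=> [b|b w w' /lift -> /lift ->//|w w' /lift hw /lift hw'].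
    exact: lifted_exists.
  rewrite hw hw'; split.
    move/(twisted_class_inj n0 (lift_twisted _ n0 zy) (lift_twisted _ n0 zy)).
    by case=> k /(pending_shift n0); rewrite !lift_pending.
  by rewrite /P_fiber (quiver_zigzag n0 zy qy) fiberP.
- rewrite twisted_cluster_bits //; have := card_range (bit_class_inj n0).
  by rewrite card_tuple card_bool.
- exact: twisted_coxeter_card.
- split=> [w tw|w w' tw tw' /(coset_comm tw tw') ww'].
    have [c /coxeter_twisted hw] := transversal_coxeter n0 tw.
    have [tc _] := @code_coxeter n c.1.1 c.1.2 (fun k => nth ord0 c.2 k).
    split; first exact: twisted_reduced hw.
    by rewrite TE; exists (code_fun c) => //; rewrite (twisted_classE hw).
  have [c hw] := transversal_coxeter n0 tw.
  rewrite -(twisted_classE (coxeter_twisted hw)).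
  exact: twisted_classE (coxeter_twisted (leads_comm ww' hw)).
- move=> w tw; have [c /coxeter_twisted hw] := transversal_coxeter n0 tw.
  have [tc cc] := @code_coxeter n c.1.1 c.1.2 (fun k => nth ord0 c.2 k).
  have zy := tc.1; set y := _ \o emb n in zy.
  exists (quiver_of n.*2 y); first exact: quiver_of_dynkin.
  split=> [|i mi].
    rewrite (quiver_zigzag n0 zy (fun _ _ => erefl)).
    by rewrite -(twisted_classE hw) P_class_twisted.
  have mj := star_letter mi; have ne : i != star n.*2 i by rewrite /star; lia.
  have := arrows_difference zy (fun _ _ => erefl) mi mj ne.
  have := cc i mi; rewrite /y /= /star; lia.
Qed.
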